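(* Let $\mathbb{F}$ be a field of characteristic different from $2$ with separable closure $\mathbb{F}_{\mathrm{sep}}$, and $n,m\ge1$. On $\mathbb{F}_{\mathrm{sep}}$-points, the lifted maps $\phi_{\mathbf{Sp}}$ and $\phi_{\mathbf{Spin}}=\phi_{r,s}$ act on Chevalley generators by the same formulas as $\rho_{\mathbf{Sp}}$ and $\rho_{\mathbf{SO}}$, with generators of $\mathbf{SO}$ replaced by the corresponding generators of $\mathbf{Spin}$. Explicitly, for $\varepsilon\in\{1,-1\}$, $t,u\in\mathbb{F}_{\mathrm{sep}}$, and indices $i<j$ in the range of the factor concerned (with single index $i$ for the roots $\pm2e_i$, $\pm e_i$), where products are in the order written and $x_\alpha(\cdot)$ on the right are generators of $\mathbf{Spin}$: (I) $\phi_{\mathbf{Sp}}\colon\mathbf{Sp}_{2n}\times\mathbf{Sp}_{2m}\to\mathbf{Spin}_{4nm}$, with $[y]=2my$: - $(x_{\varepsilon(e_i-e_j)}(t),1)\mapsto\prod_{k=1}^{2m}x_{\varepsilon(e_{[i-1]+k}-e_{[j-1]+k})}(t)$ - $(x_{\varepsilon(e_i+e_j)}(t),1)\mapsto\prod_{k=1}^{m}x_{\varepsilon(e_{[i-1]+k}+e_{[j-1]+m+k})}(t)\,x_{\varepsilon(e_{[i-1]+m+k}+e_{[j-1]+k})}(-t)$ - $(x_{2\varepsilon e_i}(t),1)\mapsto\prod_{k=1}^{m}x_{\varepsilon(e_{[i-1]+k}+e_{[i-1]+m+k})}(t)$ - $(1,x_{\varepsilon(e_i-e_j)}(u))\mapsto\prod_{k=0}^{n-1}x_{\varepsilon(e_{[k]+i}-e_{[k]+j})}(u)\,x_{-\varepsilon(e_{[k]+m+i}-e_{[k]+m+j})}(-u)$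 - $(1,x_{\varepsilon(e_i+e_j)}(u))\mapsto\prod_{k=0}^{n-1}x_{\varepsilon(e_{[k]+i}-e_{[k]+m+j})}(-u)\,x_{\varepsilon(e_{[k]+j}-e_{[k]+m+i})}(-u)$ - $(1,x_{2\varepsilon e_i}(u))\mapsto\prod_{k=0}^{n-1}x_{\varepsilon(e_{[k]+i}-e_{[k]+m+i})}(-u)$ (II) $\phi_{2n,s}\colon\mathbf{Spin}_{2n}\times\mathbf{Spin}_{s}\to\mathbf{Spin}_{2ns}$ with $s=2m$ or $s=2m+1$, $[y]=sy$, $\overline y=s+1-y$: - $(x_{\varepsilon(e_i-e_j)}(t),1)\mapsto\prod_{k=1}^{s}x_{\varepsilon(e_{[i-1]+k}-e_{[j-1]+k})}(t)$ - $(x_{\varepsilon(e_i+e_j)}(t),1)\mapsto\prod_{k=1}^{s}x_{\varepsilon(e_{[i-1]+k}+e_{[j-1]+\overline k})}(t)$ - $(1,x_{\varepsilon(e_i-e_j)}(u))\mapsto\prod_{k=0}^{n-1}x_{\varepsilon(e_{[k]+i}-e_{[k]+j})}(u)\,x_{\varepsilon(e_{[k]+\overline j}-e_{[k]+\overline i})}(-u)$ - $(1,x_{\varepsilon(e_i+e_j)}(u))\mapsto\prod_{k=0}^{n-1}x_{\varepsilon(e_{[k]+i}-e_{[k]+\overline j})}(u)\,x_{\varepsilon(e_{[k]+j}-e_{[k]+\overline i})}(-u)$ - if $s=2m+1$: $(1,x_{e_i}(u))\mapsto\prod_{k=0}^{n-1}x_{e_{[k]+i}-e_{[k]+m+1}}(\sqrt2u)\,x_{e_{[k]+m+1}-e_{[k]+\overline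 i}}(-\sqrt2u)\,x_{e_{[k]+i}-e_{[k]+\overline i}}(u^2)$ - if $s=2m+1$: $(1,x_{-e_i}(u))\mapsto\prod_{k=0}^{n-1}x_{-e_{[k]+m+1}+e_{[k]+\overline i}}(-\sqrt2u)\,x_{-e_{[k]+i}+e_{[k]+m+1}}(\sqrt2u)\,x_{-e_{[k]+i}+e_{[k]+\overline i}}(u^2)$ (III) $\phi_{2n+1,2m+1}\colon\mathbf{Spin}_{2n+1}\times\mathbf{Spin}_{2m+1}\to\mathbf{Spin}_{(2n+1)(2m+1)}$, with $[y]=(2m+1)y$, $\overline y=2m+2-y$: - $(x_{\varepsilon(e_i-e_j)}(t),1)\mapsto\prod_{k=1}^{2m+1}x_{\varepsilon(e_{[i-1]+k}-e_{[j-1]+k})}(t)$ - $(x_{\varepsilon(e_i+e_j)}(t),1)\mapsto\prod_{k=1}^{2m+1}x_{\varepsilon(e_{[i-1]+k}+e_{[j-1]+\overline k})}(t)$ - $(x_{e_i}(t),1)\mapsto\Big(\prod_{k=1}^mx_{e_{[i-1]+k}-e_{[n]+k}}(\sqrt2t)\,x_{e_{[i-1]+\overline k}+e_{[n]+k}}(\sqrt2t)\,x_{e_{[i-1]+k}+e_{[i-1]+\overline k}}(t^2)\Big)x_{e_{[i-1]+m+1}}(t)$ - $(x_{-e_i}(t),1)\mapsto\Big(\prod_{k=1}^mx_{-e_{[i-1]+\overline k}-e_{[n]+k}}(\sqrt2t)\,x_{-e_{[i-1]+k}+e_{[n]+k}}(\sqrt2t)\,x_{-e_{[i-1]+k}-e_{[i-1]+\overline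 k}}(t^2)\Big)x_{-e_{[i-1]+m+1}}(t)$ - $(1,x_{\varepsilon(e_i-e_j)}(u))\mapsto\Big(\prod_{k=0}^{n-1}x_{\varepsilon(e_{[k]+i}-e_{[k]+j})}(u)\,x_{\varepsilon(e_{[k]+\overline j}-e_{[k]+\overline i})}(-u)\Big)x_{\varepsilon(e_{[n]+i}-e_{[n]+j})}(u)$ - $(1,x_{\varepsilon(e_i+e_j)}(u))\mapsto\Big(\prod_{k=0}^{n-1}x_{\varepsilon(e_{[k]+i}-e_{[k]+\overline j})}(u)\,x_{\varepsilon(e_{[k]+j}-e_{[k]+\overline i})}(-u)\Big)x_{\varepsilon(e_{[n]+i}+e_{[n]+j})}(u)$ - $(1,x_{e_i}(u))\mapsto\Big(\prod_{k=0}^{n-1}x_{e_{[k]+i}-e_{[k]+m+1}}(\sqrt2u)\,x_{e_{[k]+m+1}-e_{[k]+\overline i}}(-\sqrt2u)\,x_{e_{[k]+i}-e_{[k]+\overline i}}(u^2)\Big)x_{e_{[n]+i}}(u)$ - $(1,x_{-e_i}(u))\mapsto\Big(\prod_{k=0}^{n-1}x_{-e_{[k]+m+1}+e_{[k]+\overline i}}(-\sqrt2u)\,x_{-e_{[k]+i}+e_{[k]+m+1}}(\sqrt2u)\,x_{-e_{[k]+i}+e_{[k]+\overline i}}(u^2)\Big)x_{-e_{[n]+i}}(u)$ In all cases the same formulas, with $x_\alpha(\cdot)$ on the right read as generators of $\mathbf{SO}$ (and, in (II) and (III), those on the left as generators of $\mathbf{SO}$), describe $\rho_{\mathbf{Sp}}$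 and $\rho_{\mathbf{SO}}$.
   Context: Groups. $\Omega_r$ is the $r\times r$ antidiagonal matrix of ones, $\Psi_{2r}=\begin{bmatrix}0&\Omega_r\\-\Omega_r&0\end{bmatrix}$. $\mathbf{SO}_d=\{A: A\,\Omega_dA^T\Omega_d=I,\ \det A=1\}$; $\mathbf{Spin}_d\twoheadrightarrow\mathbf{SO}_d$ its (split) spin double cover; $\mathbf{Sp}_{2r}=\{A: A(-\Psi_{2r}A^T\Psi_{2r})=I\}$. Chevalley generators ($E_{a,b}$ matrix units, $t\in\mathbb{F}_{\mathrm{sep}}$, $i<j$). For $\mathbf{Sp}_{2r}$ (type $C_r$, roots $\pm e_i\pm e_j,\pm2e_i$): $x_{e_i-e_j}(t)=I+t(E_{i,j}-E_{2r+1-j,2r+1-i})$, $x_{e_i+e_j}(t)=I+t(E_{i,2r+1-j}+E_{j,2r+1-i})$, $x_{2e_j}(t)=I+tE_{j,2r+1-j}$, and $x_{-\alpha}(t)=x_\alpha(t)^T$. For $\mathbf{SO}_d$, $d=2r$ (type $D_r$, roots $\pm e_i\pm e_j$) or $d=2r+1$ (type $B_r$, roots $\pm e_i\pm e_j,\pm e_i$), with $\overline i=d+1-i$: $x_{e_i-e_j}(t)=I+t(E_{i,j}-E_{\overline j,\overline i})$, $x_{e_i+e_j}(t)=I+t(E_{i,\overline j}-E_{j,\overline i})$, and for $d=2r+1$ also $x_{e_j}(t)=I+\sqrt2tE_{j,r+1}-\sqrt2tE_{r+1,\overline j}-t^2E_{j,\overline j}$ (with a fixed $\sqrt2\in\mathbb{F}_{\mathrm{sep}}$),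 and $x_{-\alpha}(t)=x_\alpha(t)^T$. $\mathbf{Spin}_d(\mathbb{F}_{\mathrm{sep}})$ is generated by elements $x_\alpha(t)$ (root subgroups, additive in $t$) mapping to the elements $x_\alpha(t)$ of $\mathbf{SO}_d$ under the natural projection. Maps. $\rho_{\mathbf{SO}}=\rho_{r,s}\colon\mathbf{SO}_r\times\mathbf{SO}_s\to\mathbf{SO}_{rs}$ is the Kronecker product $(A,B)\mapsto A\otimes B$ (the entry of $A\otimes B$ at row $(a-1)s+b$, column $(a'-1)s+b'$ is $A_{a,a'}B_{b,b'}$). $\rho_{\mathbf{Sp}}\colon\mathbf{Sp}_{2n}\times\mathbf{Sp}_{2m}\to\mathbf{SO}_{4nm}$ is $(A,B)\mapsto P^{-1}(A\otimes B)P$, where $P$ is block diagonal with $n$ blocks $\mathrm{diag}(I_m,-\Omega_m)$ followed by $n$ blocks $\mathrm{diag}(\Omega_m,I_m)$. $\phi_{\mathbf{Sp}}\colon\mathbf{Sp}_{2n}\times\mathbf{Sp}_{2m}\to\mathbf{Spin}_{4nm}$ and $\phi_{r,s}\colon\mathbf{Spin}_r\times\mathbf{Spin}_s\to\mathbf{Spin}_{rs}$ are the unique homomorphisms of group schemes lifting, along the projection from $\mathbf{Spin}$ to $\mathbf{SO}$, the map $\rho_{\mathbf{Sp}}$, respectively the composition $\mathbf{Spin}_r\times\mathbf{Spin}_s\twoheadrightarrow\mathbf{SO}_r\times\mathbf{SO}_s\xrightarrow{\rho_{r,s}}\mathbf{SO}_{rs}$. *)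

(* Defs.v *)
From HB Require Import structures.
From mathcomp Require Import all_boot all_order all_algebra all_field.
From mathcomp Require Export mxtens.

Set Implicit Arguments.
Unset Strict Implicit.
Unset Printing Implicit Defensive.

Import GRing.Theory.
Local Open Scope ring_scope.

(* L is a separable closure of F via iota: separable algebraic over F and
   separably closed. *)
Definition separable_closure (F L : fieldType) (iota : {rmorphism F -> L}) :=
  (forall x : L,
      exists2 p : {poly F}, separable_poly p & root (map_poly iota p) x) /\
  (forall q : {poly L}, separable_poly q -> (1 < size q)%N ->
      exists x : L, root q x).

(* An affine F-group scheme is given by its functor of points; the groups here
   are all defined, inside square matrices of a fixed size, by conditions that
   make sense over every commutative ring.  Quantifying over comUnitRingType
   loses no (nonzero) commutative ring, since being a unit can be decided
   classically. *)
Definition group_points (p : nat) :=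
  forall R : comUnitRingType, 'M[R]_p -> Prop.

(* A family indexed by the F-algebras a : F -> R.  Its values outside the
   groups under consideration are irrelevant. *)
Definition point_map2 (F : fieldType) (p q N : nat) :=
  forall R : comUnitRingType, {rmorphism F -> R} ->
    'M[R]_p -> 'M[R]_q -> 'M[R]_N.

(* phi is a homomorphism of F-group schemes G1 x G2 -> H, that is, a natural
   transformation of group-valued functors on F-algebras (Yoneda). *)
Definition group_scheme_hom2 (F : fieldType) (p q N : nat)
    (G1 : group_points p) (G2 : group_points q) (H : group_points N)
    (phi : point_map2 F p q N) : Prop :=
  [/\ forall (R : comUnitRingType) (a : {rmorphism F -> R}) g h,
        G1 R g -> G2 R h -> H R (phi R a g h),
      forall (R : comUnitRingType) (a : {rmorphism F -> R}) g g' h h',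
        G1 R g -> G1 R g' -> G2 R h -> G2 R h' ->
        phi R a (g *m g') (h *m h') = phi R a g h *m phi R a g' h'
    & forall (R S : comUnitRingType) (a : {rmorphism F -> R})
             (b : {rmorphism F -> S}) (f : {rmorphism R -> S}) g h,
        f \o a =1 b -> G1 R g -> G2 R h ->
        map_mx f (phi R a g h) = phi S b (map_mx f g) (map_mx f h)].

Section Groups.
Variable R : comUnitRingType.

Definition Omega d : 'M[R]_d := \matrix_(i, j) (j == rev_ord i)%:R.

Definition Psi r : 'M[R]_(r + r) := block_mx 0 (Omega r) (- Omega r) 0.

Definition SO d (A : 'M[R]_d) : Prop :=
  A *m Omega d *m A^T *m Omega d = 1%:M /\ \det A = 1.

Definition Sp r (A : 'M[R]_(r + r)) : Prop :=
  A *m (- Psi r *m A^T *m Psi r) = 1%:M.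

(* The Clifford algebra of the form b(v, w) = v^T Omega w on R^d, with
   v * v = b(v, v), is realized faithfully in the endomorphisms of the exterior
   algebra of R^d: a vector v acts by v /\ _ plus contraction with b(v, _).
   Endomorphisms are matrices in the basis e_S, S : {set 'I_d}, acting on
   columns, where e_S is the exterior product of the e_i, i in S, in increasing
   order. *)
Definition koszul_sign d (i : 'I_d) (T : {set 'I_d}) : R :=
  (-1) ^+ #|[set j in T | (j < i)%N]|.

Definition creation d (i : 'I_d) : 'M[R]_#|{set 'I_d}| :=
  \matrix_(a, b)
    let S : {set 'I_d} := enum_val a in let T : {set 'I_d} := enum_val b in
    ((i \notin T) && (S == i |: T))%:R * koszul_sign i T.

Definition contraction d (i : 'I_d) : 'M[R]_#|{set 'I_d}| :=
  \matrix_(a, b)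
    let S : {set 'I_d} := enum_val a in let T : {set 'I_d} := enum_val b in
    ((i \in T) && (S == T :\ i))%:R * koszul_sign i T.

(* b(e_i, _) is the coordinate of index rev_ord i, whence
   gamma i * gamma j + gamma j * gamma i = 2 b(e_i, e_j). *)
Definition gamma d (i : 'I_d) : 'M[R]_#|{set 'I_d}| :=
  creation i + contraction (rev_ord i).

(* The element with coordinates c in the monomial basis (enum S is increasing)
   and its image under the reversal anti-involution. *)
Definition cliff d (c : {set 'I_d} -> R) : 'M[R]_#|{set 'I_d}| :=
  \sum_(S : {set 'I_d}) c S *: \big[mulmx/1%:M]_(i <- enum S) gamma i.

Definition cliff_rev d (c : {set 'I_d} -> R) : 'M[R]_#|{set 'I_d}| :=
  \sum_(S : {set 'I_d}) c S *: \big[mulmx/1%:M]_(i <- rev (enum S)) gamma i.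

(* g v g^-1 = A v for every vector v, inside the Clifford algebra. *)
Definition vector_action d (g : 'M[R]_#|{set 'I_d}|) (A : 'M[R]_d) : Prop :=
  forall j, g *m gamma j = (\sum_i A i j *: gamma i) *m g.

(* Even elements of spinor norm 1 that stabilize the space of vectors. *)
Definition Spin d (g : 'M[R]_#|{set 'I_d}|) : Prop :=
  (exists c : {set 'I_d} -> R,
     [/\ forall S : {set 'I_d}, odd #|S| -> c S = 0, g = cliff c
       & cliff c *m cliff_rev c = 1%:M]) /\
  (exists2 A : 'M[R]_d, SO A & vector_action g A).

(* The graph of the projection Spin_d -> SO_d. *)
Definition Spin_proj d (g : 'M[R]_#|{set 'I_d}|) (A : 'M[R]_d) : Prop :=
  [/\ Spin g, SO A & vector_action g A].

(* The block diagonal matrix with n blocks diag(I_m, -Omega_m) followed by n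
   blocks diag(Omega_m, I_m). *)
Definition Pmx n m : 'M[R]_((n + n) * (m + m)) :=
  (block_mx 1%:M 0 0 0 : 'M_(n + n)) *t block_mx 1%:M 0 0 (- Omega m)
  + (block_mx 0 0 0 1%:M : 'M_(n + n)) *t block_mx (Omega m) 0 0 1%:M.

Definition rho_SO r s (A : 'M[R]_r) (B : 'M[R]_s) : 'M[R]_(r * s) := A *t B.

Definition rho_Sp n m (A : 'M[R]_(n + n)) (B : 'M[R]_(m + m)) :
    'M[R]_((n + n) * (m + m)) :=
  invmx (Pmx n m) *m (A *t B) *m Pmx n m.

End Groups.

Definition is_phi_Sp (F : fieldType) (n m : nat)
    (phi : point_map2 F (n + n) (m + m) #|{set 'I_((n + n) * (m + m))}|) :=
  group_scheme_hom2 (fun R => @Sp R n) (fun R => @Sp R m)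
    (fun R => @Spin R ((n + n) * (m + m))) phi /\
  forall (R : comUnitRingType) (a : {rmorphism F -> R}) A B,
    Sp A -> Sp B -> Spin_proj (phi R a A B) (rho_Sp A B).

Definition is_phi_Spin (F : fieldType) (r s : nat)
    (phi : point_map2 F #|{set 'I_r}| #|{set 'I_s}| #|{set 'I_(r * s)}|) :=
  group_scheme_hom2 (fun R => @Spin R r) (fun R => @Spin R s)
    (fun R => @Spin R (r * s)) phi /\
  forall (R : comUnitRingType) (a : {rmorphism F -> R}) g h A B,
    Spin_proj g A -> Spin_proj h B ->
    Spin_proj (phi R a g h) (rho_SO A B).

(* With eps = (-1) ^+ e and indices counted from 1:
   Diff e i j is eps (e_i - e_j), Sum e i j is eps (e_i + e_j), and Sing e i is
   2 eps e_i in type C and eps e_i in type B. *)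
Inductive root_label :=
  | Diff of bool & nat & nat
  | Sum of bool & nat & nat
  | Sing of bool & nat.

(* The roots of SO_d, each listed once. *)
Definition SO_root (d : nat) (al : root_label) : bool :=
  match al with
  | Diff _ i j | Sum _ i j => [&& 0 < i, i < j & j <= d./2]%N
  | Sing _ i => [&& odd d, 0 < i & i <= d./2]%N
  end.

Section Generators.
Variable R : comUnitRingType.

(* Matrix unit with indices counted from 1. *)
Definition E_ d (a b : nat) : 'M[R]_d :=
  \matrix_(i, j) ((i.+1 == a) && (j.+1 == b))%:R.

Definition xSp r (al : root_label) (t : R) : 'M[R]_(r + r) :=
  let bar y := ((2 * r).+1 - y)%N in
  let signed (e : bool) (M : 'M[R]_(r + r)) := if e then M^T else M in
  match al with
  | Diff e i j => signed e (1%:M + t *: (E_ _ i j - E_ _ (bar j) (bar i)))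
  | Sum e i j => signed e (1%:M + t *: (E_ _ i (bar j) + E_ _ j (bar i)))
  | Sing e j => signed e (1%:M + t *: E_ _ j (bar j))
  end.

Variable sqrt2 : R.

Definition xSO d (al : root_label) (t : R) : 'M[R]_d :=
  let bar y := (d.+1 - y)%N in
  let signed (e : bool) (M : 'M[R]_d) := if e then M^T else M in
  match al with
  | Diff e i j => signed e (1%:M + t *: (E_ _ i j - E_ _ (bar j) (bar i)))
  | Sum e i j => signed e (1%:M + t *: (E_ _ i (bar j) - E_ _ j (bar i)))
  | Sing e j =>
      signed e (1%:M + (sqrt2 * t) *: E_ _ j (d./2).+1
                - (sqrt2 * t) *: E_ _ (d./2).+1 (bar j)
                - t ^+ 2 *: E_ _ j (bar j))
  end.

(* Additivity and the projection determine x al: two additive lifts differ by a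
   homomorphism from a 2-divisible group to {1, -1} when R is a field of
   characteristic different from 2. *)
Definition Spin_generators d (x : root_label -> R -> 'M[R]_#|{set 'I_d}|) :=
  forall al, SO_root d al ->
    (forall t u, x al (t + u) = x al t *m x al u) /\
    (forall t, Spin_proj (x al t) (xSO d al t)).

(* In the formulas below, f is the map, x1 and x2 are the generators of the two
   factors and x those of the target; e is the sign of the root on the left. *)

Definition formulas_Sp (n m p q N : nat)
    (x1 : root_label -> R -> 'M[R]_p) (x2 : root_label -> R -> 'M[R]_q)
    (x : root_label -> R -> 'M[R]_N)
    (f : 'M[R]_p -> 'M[R]_q -> 'M[R]_N) : Prop :=
  let br y := (2 * m * y)%N in
  (forall (e : bool) (t : R) (i j : nat), (0 < i)%N -> (i < j)%N -> (j <= n)%N ->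
     f (x1 (Diff e i j) t) 1%:M =
       \big[mulmx/1%:M]_(1 <= k < (2 * m).+1)
         x (Diff e (br (i - 1)%N + k) (br (j - 1)%N + k)) t
     /\
     f (x1 (Sum e i j) t) 1%:M =
       \big[mulmx/1%:M]_(1 <= k < m.+1)
         (x (Sum e (br (i - 1)%N + k) (br (j - 1)%N + m + k)) t
          *m x (Sum e (br (i - 1)%N + m + k) (br (j - 1)%N + k)) (- t)))
  /\
  (forall (e : bool) (t : R) (i : nat), (0 < i)%N -> (i <= n)%N ->
     f (x1 (Sing e i) t) 1%:M =
       \big[mulmx/1%:M]_(1 <= k < m.+1)
         x (Sum e (br (i - 1)%N + k) (br (i - 1)%N + m + k)) t)
  /\
  (forall (e : bool) (u : R) (i j : nat), (0 < i)%N -> (i < j)%N -> (j <= m)%N ->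
     f 1%:M (x2 (Diff e i j) u) =
       \big[mulmx/1%:M]_(0 <= k < n)
         (x (Diff e (br k + i) (br k + j)) u
          *m x (Diff (~~ e) (br k + m + i) (br k + m + j)) (- u))
     /\
     f 1%:M (x2 (Sum e i j) u) =
       \big[mulmx/1%:M]_(0 <= k < n)
         (x (Diff e (br k + i) (br k + m + j)) (- u)
          *m x (Diff e (br k + j) (br k + m + i)) (- u)))
  /\
  (forall (e : bool) (u : R) (i : nat), (0 < i)%N -> (i <= m)%N ->
     f 1%:M (x2 (Sing e i) u) =
       \big[mulmx/1%:M]_(0 <= k < n) x (Diff e (br k + i) (br k + m + i)) (- u)).

(* SO_2n x SO_s, where m = s./2. *)
Definition formulas_SO_even (n s p q N : nat)
    (x1 : root_label -> R -> 'M[R]_p) (x2 : root_label -> R -> 'M[R]_q)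
    (x : root_label -> R -> 'M[R]_N)
    (f : 'M[R]_p -> 'M[R]_q -> 'M[R]_N) : Prop :=
  let m := s./2 in
  let br y := (s * y)%N in
  let bar y := (s.+1 - y)%N in
  (forall (e : bool) (t : R) (i j : nat), (0 < i)%N -> (i < j)%N -> (j <= n)%N ->
     f (x1 (Diff e i j) t) 1%:M =
       \big[mulmx/1%:M]_(1 <= k < s.+1)
         x (Diff e (br (i - 1)%N + k) (br (j - 1)%N + k)) t
     /\
     f (x1 (Sum e i j) t) 1%:M =
       \big[mulmx/1%:M]_(1 <= k < s.+1)
         x (Sum e (br (i - 1)%N + k) (br (j - 1)%N + bar k)) t)
  /\
  (forall (e : bool) (u : R) (i j : nat), (0 < i)%N -> (i < j)%N -> (j <= m)%N ->
     f 1%:M (x2 (Diff e i j) u) =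
       \big[mulmx/1%:M]_(0 <= k < n)
         (x (Diff e (br k + i) (br k + j)) u
          *m x (Diff e (br k + bar j) (br k + bar i)) (- u))
     /\
     f 1%:M (x2 (Sum e i j) u) =
       \big[mulmx/1%:M]_(0 <= k < n)
         (x (Diff e (br k + i) (br k + bar j)) u
          *m x (Diff e (br k + j) (br k + bar i)) (- u)))
  /\
  (odd s -> forall (u : R) (i : nat), (0 < i)%N -> (i <= m)%N ->
     f 1%:M (x2 (Sing false i) u) =
       \big[mulmx/1%:M]_(0 <= k < n)
         (x (Diff false (br k + i) (br k + m + 1)) (sqrt2 * u)
          *m x (Diff false (br k + m + 1) (br k + bar i)) (- (sqrt2 * u))
          *m x (Diff false (br k + i) (br k + bar i)) (u ^+ 2))
     /\
     f 1%:M (x2 (Sing true i) u) =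
       \big[mulmx/1%:M]_(0 <= k < n)
         (x (Diff true (br k + m + 1) (br k + bar i)) (- (sqrt2 * u))
          *m x (Diff true (br k + i) (br k + m + 1)) (sqrt2 * u)
          *m x (Diff true (br k + i) (br k + bar i)) (u ^+ 2))).

(* SO_(2n+1) x SO_(2m+1). *)
Definition formulas_SO_odd (n m p q N : nat)
    (x1 : root_label -> R -> 'M[R]_p) (x2 : root_label -> R -> 'M[R]_q)
    (x : root_label -> R -> 'M[R]_N)
    (f : 'M[R]_p -> 'M[R]_q -> 'M[R]_N) : Prop :=
  let br y := ((2 * m + 1) * y)%N in
  let bar y := (2 * m + 2 - y)%N in
  (forall (e : bool) (t : R) (i j : nat), (0 < i)%N -> (i < j)%N -> (j <= n)%N ->
     f (x1 (Diff e i j) t) 1%:M =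
       \big[mulmx/1%:M]_(1 <= k < (2 * m + 1).+1)
         x (Diff e (br (i - 1)%N + k) (br (j - 1)%N + k)) t
     /\
     f (x1 (Sum e i j) t) 1%:M =
       \big[mulmx/1%:M]_(1 <= k < (2 * m + 1).+1)
         x (Sum e (br (i - 1)%N + k) (br (j - 1)%N + bar k)) t)
  /\
  (forall (t : R) (i : nat), (0 < i)%N -> (i <= n)%N ->
     f (x1 (Sing false i) t) 1%:M =
       (\big[mulmx/1%:M]_(1 <= k < m.+1)
         (x (Diff false (br (i - 1)%N + k) (br n + k)) (sqrt2 * t)
          *m x (Sum false (br (i - 1)%N + bar k) (br n + k)) (sqrt2 * t)
          *m x (Sum false (br (i - 1)%N + k) (br (i - 1)%N + bar k)) (t ^+ 2)))
       *m x (Sing false (br (i - 1)%N + m + 1)) t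
     /\
     f (x1 (Sing true i) t) 1%:M =
       (\big[mulmx/1%:M]_(1 <= k < m.+1)
         (x (Sum true (br (i - 1)%N + bar k) (br n + k)) (sqrt2 * t)
          *m x (Diff true (br (i - 1)%N + k) (br n + k)) (sqrt2 * t)
          *m x (Sum true (br (i - 1)%N + k) (br (i - 1)%N + bar k)) (t ^+ 2)))
       *m x (Sing true (br (i - 1)%N + m + 1)) t)
  /\
  (forall (e : bool) (u : R) (i j : nat), (0 < i)%N -> (i < j)%N -> (j <= m)%N ->
     f 1%:M (x2 (Diff e i j) u) =
       (\big[mulmx/1%:M]_(0 <= k < n)
         (x (Diff e (br k + i) (br k + j)) u
          *m x (Diff e (br k + bar j) (br k + bar i)) (- u)))
       *m x (Diff e (br n + i) (br n + j)) u
     /\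
     f 1%:M (x2 (Sum e i j) u) =
       (\big[mulmx/1%:M]_(0 <= k < n)
         (x (Diff e (br k + i) (br k + bar j)) u
          *m x (Diff e (br k + j) (br k + bar i)) (- u)))
       *m x (Sum e (br n + i) (br n + j)) u)
  /\
  (forall (u : R) (i : nat), (0 < i)%N -> (i <= m)%N ->
     f 1%:M (x2 (Sing false i) u) =
       (\big[mulmx/1%:M]_(0 <= k < n)
         (x (Diff false (br k + i) (br k + m + 1)) (sqrt2 * u)
          *m x (Diff false (br k + m + 1) (br k + bar i)) (- (sqrt2 * u))
          *m x (Diff false (br k + i) (br k + bar i)) (u ^+ 2)))
       *m x (Sing false (br n + i)) u
     /\
     f 1%:M (x2 (Sing true i) u) =
       (\big[mulmx/1%:M]_(0 <= k < n)
         (x (Diff true (br k + m + 1) (br k + bar i)) (- (sqrt2 * u))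
          *m x (Diff true (br k + i) (br k + m + 1)) (sqrt2 * u)
          *m x (Diff true (br k + i) (br k + bar i)) (u ^+ 2)))
       *m x (Sing true (br n + i)) u).

End Generators.

(* Main.v *)
Require Import Defs.
From mathcomp Require Import all_boot all_order all_algebra all_field ring zify.

(* Over the separable closure every element is twice another one.  Two lifts to
   Spin of the same element of SO differ by a sign, so two lifts to Spin of the
   same one-parameter subgroup of SO that are themselves additive agree: the
   values at t are the squares of the values at t / 2.  For the same reason
   root subgroups that commute in SO commute in Spin, and a commutator that is
   a third root subgroup in SO is the corresponding one in Spin.  Hence each
   product on the right-hand side of a formula is additive in its parameter, and
   the formulas for Spin follow from those for SO and Sp, which are identities
   between Kronecker products of matrix units. *)

Set Implicit Arguments.
Unset Strict Implicit.
Unset Printing Implicit Defensive.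

Import GRing.Theory.
Local Open Scope ring_scope.

(** * The exterior algebra *)

(** Two obstacles shape the proof. Evenness and norm 1 are stated in Clifford coordinates, which
    behave badly under products; they are replaced by two multiplicative consequences, commutation
    with the operators [cogamma] and invariance of [ext_rev]. Once 2 is invertible, [gamma] and
    [cogamma] together yield all creation and contraction operators, whose common centralizer
    consists of the scalars; this is why two lifts agree up to sign. The other obstacle is that a
    root element of the large orthogonal group touches a block and its mirror image under reversal
    of indices, whereas the Kronecker product of the identity with a root element repeats all of
    that element in every block. Hence the factors come in mirror pairs. For long roots the
    nilpotent parts in a pair are orthogonal and simply add. For short roots they meet in the middle
    index, do not commute and generate a Heisenberg group; the factor with parameter [t ^+ 2] is the
    correction that makes the product additive again, and the square root of 2 is the constant for
    which it does. *)

Section ExteriorAlgebra.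
Variables (R : comUnitRingType) (d : nat).
Implicit Types (i j : 'I_d) (T : {set 'I_d}).

Definition ext_basis T : 'cV[R]_#|{set 'I_d}| := delta_mx (enum_rank T) 0.

Lemma ext_basis_inj p (X Y : 'M[R]_(p, _)) :
  (forall T, X *m ext_basis T = Y *m ext_basis T) -> X = Y.
Proof.
move=> eqXY; apply/matrixP=> a b.
have := eqXY (enum_val b); rewrite /ext_basis enum_valK -!colE.
by move/matrixP/(_ a 0); rewrite !mxE.
Qed.

Lemma creation_ext_basis i T : creation R i *m ext_basis T =
  ((i \notin T)%:R * koszul_sign R i T) *: ext_basis (i |: T).
Proof.
apply/matrixP=> a b; rewrite -colE !mxE enum_rankK ord1 eqxx andbT.
rewrite -(can2_eq enum_valK enum_rankK).
by rewrite /= -mulnb natrM mulrAC.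
Qed.

Lemma contraction_ext_basis i T : contraction R i *m ext_basis T =
  ((i \in T)%:R * koszul_sign R i T) *: ext_basis (T :\ i).
Proof.
apply/matrixP=> a b; rewrite -colE !mxE enum_rankK ord1 eqxx andbT.
rewrite -(can2_eq enum_valK enum_rankK).
by rewrite /= -mulnb natrM mulrAC.
Qed.

Lemma koszul_signU1 i j T : j \notin T ->
  koszul_sign R i (j |: T) = (-1) ^+ (j < i)%N * koszul_sign R i T.
Proof.
move=> jT; rewrite /koszul_sign -exprD; congr (_ ^+ _).
rewrite (cardsD1 j) !inE eqxx /=; congr (_ + _)%N; apply: eq_card => k.
rewrite !inE; case: eqP => [->|] //=; by rewrite (negPf jT).
Qed.

Lemma koszul_sign_self i T : koszul_sign R i (T :\ i) = koszul_sign R i T.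
Proof.
congr (_ ^+ _); apply: eq_card => k; rewrite !inE.
by case: eqP => [->|] //=; rewrite ltnn andbF.
Qed.

Lemma koszul_signD1 i j T : j \in T ->
  koszul_sign R i (T :\ j) = (-1) ^+ (j < i)%N * koszul_sign R i T.
Proof.
move=> jT; rewrite -{2}(setD1K jT) koszul_signU1 ?setD11 //.
by rewrite mulrA -expr2 sqrr_sign mul1r.
Qed.

Lemma koszul_sign_sqr i T : koszul_sign R i T * koszul_sign R i T = 1.
Proof. by rewrite -expr2 sqrr_sign. Qed.

(** In the basis e_S contraction is the adjoint of creation, so each relation between creation
    operators gives one between contractions by transposition. *)
Lemma trmx_creation i : (creation R i)^T = contraction R i.
Proof.
apply/matrixP=> a b; rewrite !mxE /=.
move: (enum_val a : {set 'I_d}) (enum_val b : {set 'I_d}) => S T.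
have [iS|iS] := boolP (i \in S) => /=.
  have -> : (i \in T) && (S == T :\ i) = false.
    apply/negbTE/negP => /andP[_ /eqP ST]; by rewrite ST !inE eqxx in iS.
  by rewrite !mul0r.
have [TS|TS] := eqVneq T (i |: S).
  rewrite TS setU11 /= /reverse_coercion setU1K // eqxx /= !mul1r.
  by rewrite -[RHS]koszul_sign_self setU1K.
have [iT|] := boolP (i \in T) => /=; last by rewrite !mul0r.
have -> : (S == T :\ i) = false.
  by apply/negbTE; apply: contraNN TS => /eqP->; rewrite setD1K.
by rewrite !mul0r.
Qed.

Lemma trmx_contraction i : (contraction R i)^T = creation R i.
Proof. by rewrite -trmx_creation trmxK. Qed.

Lemma creation_anticomm i j :
  creation R i *m creation R j = - (creation R j *m creation R i).
Proof.
apply: ext_basis_inj => T; rewrite mulNmx -!mulmxA !creation_ext_basis.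
rewrite -!scalemxAr !creation_ext_basis !scalerA -scaleNr setUCA.
congr (_ *: _); rewrite !inE.
case: (ltngtP i j) => [ij|ij|/val_inj->]; last by rewrite eqxx /=; ring.
- case: (boolP (i \in T)) => iT; rewrite ?orbT /= ?mul0r ?mulr0 ?oppr0 //.
  case: (boolP (j \in T)) => jT; rewrite ?orbT /= ?mul0r ?mulr0 ?oppr0 //.
  rewrite !orbF !koszul_signU1 // ij ltnNge (ltnW ij) /= -!val_eqE /= (ltn_eqF ij)
    (gtn_eqF ij) /=; ring.
- case: (boolP (i \in T)) => iT; rewrite ?orbT /= ?mul0r ?mulr0 ?oppr0 //.
  case: (boolP (j \in T)) => jT; rewrite ?orbT /= ?mul0r ?mulr0 ?oppr0 //.
  rewrite !orbF !koszul_signU1 // ij ltnNge (ltnW ij) /= -!val_eqE /= (ltn_eqF ij)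
    (gtn_eqF ij) /=; ring.
Qed.

Lemma contraction_anticomm i j :
  contraction R i *m contraction R j = - (contraction R j *m contraction R i).
Proof.
by rewrite -!trmx_creation -!trmx_mul creation_anticomm linearN.
Qed.

(** The canonical anticommutation relation. For [i = j] exactly one of the two composites is nonzero
    on a given basis vector. For [i != j] exactly one of the two indices precedes the other, so
    exactly one of the two Koszul signs changes. *)
Lemma creation_contraction i j : creation R i *m contraction R j =
  (i == j)%:R%:M - contraction R j *m creation R i.
Proof.
apply: ext_basis_inj => T.
rewrite mulmxBl -!mulmxA creation_ext_basis contraction_ext_basis.
rewrite -!scalemxAr creation_ext_basis contraction_ext_basis !scalerA.
rewrite mul_scalar_mx.
have [<-|nij] := eqVneq i j.
  rewrite !inE eqxx /= scale1r koszul_sign_self.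
  have [iT|iT] := boolP (i \in T); rewrite /= !(mulr1, mul1r, mul0r, mulr0).
    by rewrite koszul_sign_sqr setD1K // scale1r scale0r subr0.
  by rewrite -(koszul_sign_self i (i |: T)) setU1K // koszul_sign_sqr scale1r
    scale0r subrr.
have -> : (i |: T) :\ j = i |: (T :\ j).
  apply/setP=> k; rewrite !inE; case: (eqVneq k i) => [->|] //=.
  by rewrite nij.
rewrite scale0r sub0r -scaleNr; congr (_ *: _).
rewrite !inE (eq_sym j i) (negPf nij) /=.
case: (boolP (i \in T)) => iT; rewrite /= ?andbF ?mul0r ?mulr0 ?oppr0 //.
case: (boolP (j \in T)) => jT; rewrite /= ?mul0r ?mulr0 ?oppr0 //.
rewrite koszul_signD1 // koszul_signU1 //.
move: nij; rewrite -val_eqE /=.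
by case: (ltngtP i j) => //= _ _; ring.
Qed.

(* Right multiplication by e_i, up to the parity operator. *)
Definition cogamma i := creation R i - contraction R (rev_ord i).

Lemma cogamma_gamma i j : cogamma i *m gamma R j = - (gamma R j *m cogamma i).
Proof.
rewrite /cogamma /gamma mulmxBl !mulmxDr !mulmxDl !mulmxN.
rewrite (creation_anticomm i j) (creation_contraction i).
rewrite (creation_contraction j) (contraction_anticomm (rev_ord j)).
rewrite (eq_sym j) (can2_eq (@rev_ordK _) (@rev_ordK _)).
move: (creation R i) (creation R j) (contraction R _) (contraction R _) => a b c e.
rewrite !opprD !opprK /=.
move: (_%:M) (a *m b) (b *m a) (e *m c) (e *m a) (c *m e) (c *m b) => m1 m2 m3 m4
  m5 m6 m7.
apply/matrixP=> k l; rewrite !mxE; ring.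
Qed.

(* The reversal anti-involution read on matrices: gamma_i is conjugate under
   this signed permutation to its transpose. *)
Definition ext_rev : 'M[R]_#|{set 'I_d}| :=
  \matrix_(a, b) let T : {set 'I_d} := enum_val b in
    ((enum_val a : {set 'I_d}) == @rev_ord d @: T)%:R * (-1) ^+ 'C(#|T|, 2).

Lemma ext_rev_ext_basis T :
  ext_rev *m ext_basis T = (-1) ^+ 'C(#|T|, 2) *: ext_basis (@rev_ord d @: T).
Proof.
apply/matrixP=> a b; rewrite -colE !mxE enum_rankK ord1 eqxx andbT.
by rewrite -(can2_eq enum_valK enum_rankK) mulrC.
Qed.

Lemma revset_K T : @rev_ord d @: (@rev_ord d @: T) = T.
Proof.
rewrite -imset_comp (eq_imset (g := id)) ?imset_id // => i /=.
exact: rev_ordK.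
Qed.

Lemma card_revset T : #|@rev_ord d @: T| = #|T|.
Proof. exact/card_imset/rev_ord_inj. Qed.

Lemma ext_rev_sqr : ext_rev *m ext_rev = 1%:M.
Proof.
apply: ext_basis_inj => T; rewrite -mulmxA ext_rev_ext_basis -scalemxAr.
rewrite ext_rev_ext_basis revset_K card_revset scalerA -expr2 sqrr_sign.
by rewrite scale1r mul1mx.
Qed.

Lemma trmx_ext_rev : ext_rev^T = ext_rev.
Proof.
apply/matrixP=> a b; rewrite !mxE /=.
move: (enum_val a : {set 'I_d}) (enum_val b : {set 'I_d}) => S T.
have -> : (S == @rev_ord d @: T) = (T == @rev_ord d @: S).
  by apply/eqP/eqP => ->; rewrite revset_K.
by case: eqP => [->|_]; rewrite ?mul0r // card_revset.
Qed.

(** Adding [i] to [T] raises the binomial exponent by [#|T|]. The set [T] splits into the elements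
    before [i] and those after it, and the latter become the elements before [rev_ord i] in the
    reversed set; so the two Koszul signs multiply to [(-1) ^+ #|T|]. *)
Lemma ext_rev_creation i :
  ext_rev *m creation R i = creation R (rev_ord i) *m ext_rev.
Proof.
apply: ext_basis_inj => T; rewrite -!mulmxA creation_ext_basis ext_rev_ext_basis.
rewrite -!scalemxAr ext_rev_ext_basis creation_ext_basis !scalerA imsetU1.
congr (_ *: _); rewrite mem_imset; last exact: rev_ord_inj.
have [iT|iT] := boolP (i \in T); rewrite /= ?mul0r ?mulr0 //.
rewrite cardsU1 iT add1n binS bin1 addnC exprD !mul1r.
suff -> : (-1) ^+ #|T| = koszul_sign R i T * koszul_sign R (rev_ord i) (@rev_ord d
  @: T).
  have := koszul_sign_sqr i T; move: (koszul_sign R i T) => k kk.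
  transitivity (k * k * koszul_sign R (rev_ord i) (@rev_ord d @: T) * (-1) ^+
    'C(#|T|, 2)); first by ring.
  by rewrite kk; ring.
rewrite /koszul_sign -exprD; congr (_ ^+ _).
rewrite -(cardsID [set j : 'I_d | (j < i)%N] T); congr (_ + _)%N.
  by apply: eq_card => k; rewrite !inE.
rewrite -(card_revset (_ :\: _)); apply: eq_card => k.
rewrite -(rev_ordK k); move: (rev_ord k) => {}k.
rewrite inE !mem_imset ?inE; try exact: rev_ord_inj.
have [kT|_] := boolP (k \in T); rewrite ?andbF ?andbT //=.
have : k != i by apply: contraNneq iT => <-.
rewrite -val_eqE /=; have := ltn_ord k; have := ltn_ord i.
by move: (nat_of_ord k) (nat_of_ord i) => x y; lia.
Qed.
End ExteriorAlgebra.

Section BigMulmx.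
Variables (R : comUnitRingType) (K : nat) (I : Type).
Implicit Types (s : seq I) (F G : I -> 'M[R]_K).

Lemma big_mulmx_rcons s i F : \big[mulmx/1%:M]_(k <- rcons s i) F k =
  (\big[mulmx/1%:M]_(k <- s) F k) *m F i.
Proof.
elim: s => [|a s IHs]; rewrite /= ?big_cons ?big_nil ?mulmx1 ?mul1mx //.
by rewrite IHs mulmxA.
Qed.

Lemma trmx_big_mulmx s F : (\big[mulmx/1%:M]_(k <- s) F k)^T =
  \big[mulmx/1%:M]_(k <- rev s) (F k)^T.
Proof.
elim: s => [|a s IHs]; first by rewrite !big_nil trmx1.
by rewrite rev_cons big_mulmx_rcons -IHs big_cons trmx_mul.
Qed.

Lemma big_mulmx_intertwine s (X : 'M[R]_K) F G :
  (forall i, X *m F i = G i *m X) ->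
  X *m \big[mulmx/1%:M]_(k <- s) F k = (\big[mulmx/1%:M]_(k <- s) G k) *m X.
Proof.
move=> FG; elim: s => [|a s IHs]; first by rewrite !big_nil mulmx1 mul1mx.
by rewrite !big_cons mulmxA FG -!mulmxA IHs.
Qed.

End BigMulmx.

(** * Lifts to the spin group and their uniqueness up to sign *)

Section SpinLift.
Variables (R : comUnitRingType) (d : nat).
Implicit Types (i j : 'I_d) (g h : 'M[R]_#|{set 'I_d}|) (A B : 'M[R]_d).

Local Notation J := (ext_rev R d).

Lemma trmx_gamma i : (gamma R i)^T = gamma R (rev_ord i).
Proof.
by rewrite /gamma linearD /= trmx_creation trmx_contraction rev_ordK addrC.
Qed.

Lemma ext_rev_gamma i : J *m gamma R i = gamma R (rev_ord i) *m J.
Proof.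
rewrite /gamma mulmxDr mulmxDl ext_rev_creation rev_ordK; congr (_ + _).
apply: trmx_inj; rewrite !trmx_mul trmx_ext_rev !trmx_contraction.
by rewrite ext_rev_creation.
Qed.

(** Transposition reverses a product of gammas and also reverses their indices; conjugation by
    [ext_rev] undoes only the second effect. The spinor norm thus becomes a condition on a matrix
    and its transpose. *)
Lemma cliff_rev_ext_rev (c : {set 'I_d} -> R) :
  cliff_rev c *m J = J *m (cliff c)^T.
Proof.
rewrite /cliff_rev /cliff linear_sum mulmx_suml mulmx_sumr.
apply: eq_bigr => S _; rewrite linearZ /= -scalemxAl -scalemxAr; congr (_ *: _).
rewrite trmx_big_mulmx; symmetry; apply: big_mulmx_intertwine => i.
by rewrite trmx_gamma ext_rev_gamma rev_ordK.
Qed.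

(** A monomial of length k picks up the sign [(-1) ^+ k] when [cogamma] passes through it, and only
    even monomials occur. *)
Lemma even_cliff_cogamma (c : {set 'I_d} -> R) j :
  (forall S : {set 'I_d}, odd #|S| -> c S = 0) ->
  cogamma R j *m cliff c = cliff c *m cogamma R j.
Proof.
move=> c_even; rewrite /cliff mulmx_suml mulmx_sumr; apply: eq_bigr => S _.
rewrite -scalemxAl -scalemxAr.
have anti (s : seq 'I_d) :
    cogamma R j *m (\big[mulmx/1%:M]_(i <- s) gamma R i) =
    (-1) ^+ size s *: (\big[mulmx/1%:M]_(i <- s) gamma R i) *m cogamma R j.
  elim: s => [|i s IHs]; first by rewrite !big_nil scale1r mulmx1 mul1mx.
  rewrite !big_cons mulmxA cogamma_gamma mulNmx -mulmxA IHs /= exprS mulN1r.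
  by rewrite scaleNr mulNmx -!scalemxAl -scalemxAr mulmxA.
rewrite anti -cardE -signr_odd; have [/c_even->|_] := boolP (odd #|S|).
  by rewrite !scale0r.
by rewrite scale1r.
Qed.

(** The irreducibility of Fock space. Dividing [gamma + cogamma] by 2 shows that [z] commutes with
    creations, hence with contractions. Contractions kill the vacuum vector of the empty set, which
    forces [z] to scale it, and creations carry the vacuum to every basis vector. *)
Lemma scalar_of_commute_gamma (z : 'M[R]_#|{set 'I_d}|) :
  2%:R \is a @GRing.unit R ->
  (forall j, z *m gamma R j = gamma R j *m z) ->
  (forall j, z *m cogamma R j = cogamma R j *m z) -> exists a, z = a%:M.
Proof.
move=> unit2 z_gamma z_cogamma.
have z_creation j : z *m creation R j = creation R j *m z.
  have -> : creation R j = 2%:R^-1 *: (gamma R j + cogamma R j).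
    rewrite /gamma /cogamma addrACA subrr addr0 -mulr2n -scaler_nat scalerA.
    by rewrite mulVr // scale1r.
  by rewrite -scalemxAl -scalemxAr mulmxDl mulmxDr z_gamma z_cogamma.
have z_contraction j : z *m contraction R j = contraction R j *m z.
  have -> : contraction R j = gamma R (rev_ord j) - creation R (rev_ord j).
    by rewrite /gamma rev_ordK addrC addKr.
  by rewrite mulmxBl mulmxBr z_gamma z_creation.
pose e (T : {set 'I_d}) := ext_basis R T.
have eE i (T : {set 'I_d}) : i \notin T -> e (i |: T) = koszul_sign R i T *:
  (creation R i *m e T).
  by move=> iT; rewrite creation_ext_basis iT mul1r scalerA koszul_sign_sqr scale1r.
pose a := z (enum_rank (set0 : {set 'I_d})) (enum_rank (set0 : {set 'I_d})).
have z0 : z *m e set0 = a *: e set0.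
  apply/matrixP=> k l; rewrite -colE !mxE ord1 eqxx andbT.
  rewrite -(enum_valK k); move: (enum_val k) => S.
  rewrite (can_eq enum_rankK).
  have [->|[i iS]] := set_0Vmem S; first by rewrite eqxx mulr1.
  have /negbTE-> : S != set0 by apply/set0Pn; exists i.
  rewrite mulr0.
  have -> : z (enum_rank S) (enum_rank (set0 : {set 'I_d})) =
            ((e S)^T *m z *m e set0) 0 0.
    rewrite /e /ext_basis trmx_delta -rowE -colE !mxE. done.
  (* The coefficient at a nonempty [S] is a matrix entry: the creation of [i] on the left transposes
     to a contraction, which moves across [z] and vanishes on the vacuum. *)
  rewrite -(setD1K iS) eE ?setD11 // linearZ /= trmx_mul trmx_creation.
  rewrite -!scalemxAl -!mulmxA (mulmxA (contraction _ _)) -z_contraction.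
  by rewrite -!mulmxA contraction_ext_basis inE mul0r scale0r !mulmx0 scaler0 mxE.
exists a; apply: ext_basis_inj => T; rewrite mul_scalar_mx -/(e T).
elim: {T}_.+1 {-2}T (ltnSn #|T|) => // k IHk T ltTk.
have [->|[i iT]] := set_0Vmem T; first exact: z0.
rewrite -(setD1K iT) eE ?setD11 // -scalemxAr mulmxA z_creation -mulmxA IHk.
  by rewrite -scalemxAr !scalerA mulrC.
by move: ltTk; rewrite (cardsD1 i T) iT.
Qed.

(* The three conditions are multiplicative in (g, A); the first two express
   evenness and norm 1 without reference to Clifford coordinates. *)
Definition spin_lift g A :=
  [/\ forall j, g *m cogamma R j = cogamma R j *m g, g *m J *m g^T = J
    & vector_action g A].

Lemma Spin_proj_lift g A : Spin_proj g A -> spin_lift g A.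
Proof.
case=> -[[c [c_even -> c_norm]] _] _ gA; split=> // [j|].
  by rewrite even_cliff_cogamma.
by rewrite -mulmxA -cliff_rev_ext_rev mulmxA c_norm mul1mx.
Qed.

Lemma spin_lift1 : spin_lift 1%:M 1%:M.
Proof.
split=> [j||j]; rewrite ?trmx1 ?mulmx1 ?mul1mx //.
rewrite (bigD1 j) //= mxE eqxx scale1r big1 ?addr0 // => i /negbTE ij.
by rewrite mxE ij scale0r.
Qed.

Lemma spin_lift_mul g h A B :
  spin_lift g A -> spin_lift h B -> spin_lift (g *m h) (A *m B).
Proof.
move=> [g_even g_norm gA] [h_even h_norm hB]; split=> [j||j].
- by rewrite -mulmxA h_even !mulmxA g_even.
- rewrite trmx_mul; transitivity (g *m (h *m J *m h^T) *m g^T).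
    by rewrite !mulmxA.
  by rewrite h_norm.
rewrite -mulmxA hB !mulmxA; congr (_ *m h); rewrite mulmx_sumr.
under eq_bigr => i _ do rewrite -scalemxAr gA scalemxAl.
rewrite -mulmx_suml; congr (_ *m g).
under eq_bigr => i _ do rewrite scaler_sumr.
rewrite exchange_big; apply: eq_bigr => i _ /=.
rewrite mxE scaler_suml; apply: eq_bigr => k _.
by rewrite scalerA mulrC.
Qed.
End SpinLift.

(** The norm condition makes [J *m h^T *m J] an inverse of [h]. Its product with [g] commutes with
    every [gamma], because both elements act by the same [A], and with every [cogamma]; it is
    therefore a scalar, whose square is 1 by the norm condition. *)
Lemma spin_lift_unique (R : fieldType) d (g h : 'M[R]_#|{set 'I_d}|) A :
  2%:R != 0 :> R -> spin_lift g A -> spin_lift h A -> g = h \/ g = - h.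
Proof.
move=> two0 [g_even g_norm gA] [h_even h_norm hA].
pose J := ext_rev R d; pose h' := J *m h^T *m J.
have hh' : h *m h' = 1%:M by rewrite /h' !mulmxA h_norm ext_rev_sqr.
have h'h : h' *m h = 1%:M by apply: mulmx1C.
clearbody h'.
have inv_comm X Y : h *m X = Y *m h -> X *m h' = h' *m Y.
  move=> hX; rewrite -[X]mul1mx -h'h -(mulmxA h') hX -!mulmxA hh'.
  by rewrite mulmx1.
have unit2 : 2%:R \is a @GRing.unit R by rewrite unitfE.
have [j|j|a za] := @scalar_of_commute_gamma R d (h' *m g) unit2.
- by rewrite -mulmxA gA !mulmxA -(inv_comm _ _ (hA j)).
- by rewrite -mulmxA g_even !mulmxA -(inv_comm _ _ (h_even j)).
have gh : g = a *: h.
  by rewrite -[g]mul1mx -hh' -mulmxA za mul_mx_scalar.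
have a2 : a ^+ 2 = 1.
  move: g_norm; rewrite gh linearZ /= -!scalemxAl -scalemxAr scalerA h_norm.
  move/(congr1 (mulmx^~ J)); rewrite -scalemxAl !ext_rev_sqr -expr2.
  (* Scalar matrices determine their scalar because the size is positive: the empty set indexes a
     basis vector, even for [d = 0]. *)
  have i : 'I_#|{set 'I_d}| by exact: (enum_rank (set0 : {set 'I_d})).
  by move/matrixP/(_ i i); rewrite !mxE eqxx mulr1.
by move/eqP: a2; rewrite sqrf_eq1 gh => /orP[]/eqP->;
  [left; rewrite scale1r | right; rewrite scaleN1r].
Qed.

(** * One-parameter subgroups and their lifts *)

(* What is used of Spin -> SO; the identity of SO is another instance, so that
   the formulas for Spin and for SO are proved together. *)
Definition sign_cover (R : nzRingType) (K N : nat)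
    (lift : 'M[R]_K -> 'M[R]_N -> Prop) : Prop :=
  [/\ lift 1%:M 1%:M,
      forall g h A B, lift g A -> lift h B -> lift (g *m h) (A *m B)
    & forall g h A, lift g A -> lift h A -> g = h \/ g = - h].

Definition one_param (R : nzRingType) (K N : nat)
    (lift : 'M[R]_K -> 'M[R]_N -> Prop)
    (y : R -> 'M[R]_K) (Y : R -> 'M[R]_N) : Prop :=
  (forall t u, y (t + u) = y t *m y u) /\ (forall t, lift (y t) (Y t)).

Lemma sign_cover_eq (R : nzRingType) N : sign_cover (@eq 'M[R]_N).
Proof. by split=> // [g h A B -> -> | g h A -> ->]; [|left]. Qed.

Lemma sign_cover_spin (R : fieldType) d :
  2%:R != 0 :> R -> sign_cover (@spin_lift R d).
Proof.
move=> two0; split; [exact: spin_lift1 | exact: spin_lift_mul |].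
by move=> g h A; apply: spin_lift_unique.
Qed.

Section OneParam.
Variables (R : fieldType) (K N : nat) (lift : 'M[R]_K -> 'M[R]_N -> Prop).
Hypotheses (two0 : 2%:R != 0 :> R) (cover : sign_cover lift).
Implicit Types (y z : R -> 'M[R]_K) (Y Z : R -> 'M[R]_N).

Let lift1 : lift 1%:M 1%:M. Proof. by case: cover. Qed.
Let liftM g h A B : lift g A -> lift h B -> lift (g *m h) (A *m B).
Proof. by case: cover => _ + _; apply. Qed.
Let lift_unique g h A : lift g A -> lift h A -> g = h \/ g = - h.
Proof. by case: cover => _ _; apply. Qed.

Lemma half_sum (t : R) : exists u, t = u + u.
Proof. by exists (t / 2%:R); rewrite -mulrDl -[t + t]mulr2n -[t *+ 2]mulr_natr
  mulfK. Qed.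

Lemma one_param_ext y z Y Z :
  y =1 z -> Y =1 Z -> one_param lift y Y -> one_param lift z Z.
Proof.
by move=> yz YZ [yD yY]; split=> [t u | t]; rewrite -?yz -?YZ.
Qed.

Lemma one_param1 : one_param lift (fun=> 1%:M) (fun=> 1%:M).
Proof. by split=> // t u; rewrite mulmx1. Qed.

(* The sign at t is a square, because y t = y (t / 2) *m y (t / 2). *)
Lemma one_param_unique y z Y :
  one_param lift y Y -> one_param lift z Y -> y =1 z.
Proof.
move=> [yD yY] [zD zY] t; have [u ->] := half_sum t; rewrite yD zD.
by have [->|->] := lift_unique (yY u) (zY u); rewrite ?mulNmx ?mulmxN ?opprK.
Qed.

(** Both orders of the product lift the same element, hence differ by a sign. Passing [g] through
    [y t] means passing it through [y u] twice, for [u] the half of [t], so the sign cancels. *)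
Lemma one_param_commute y Y g A t :
  one_param lift y Y -> lift g A -> (forall u, Y u *m A = A *m Y u) ->
  y t *m g = g *m y t.
Proof.
move=> [yD yY] gA YA; have [u ->] := half_sum t; rewrite yD.
have [||yg|yg] := @lift_unique (y u *m g) (g *m y u) (Y u *m A).
- exact: liftM.
- by rewrite YA; apply: liftM.
- by rewrite -mulmxA yg !mulmxA yg.
- by rewrite -mulmxA yg mulmxN !mulmxA yg mulNmx opprK.
Qed.

Lemma one_param_mul y Y z Z :
  one_param lift y Y -> one_param lift z Z ->
  (forall t u, Y t *m Z u = Z u *m Y t) ->
  one_param lift (fun t => y t *m z t) (fun t => Y t *m Z t).
Proof.
move=> y1 z1 YZ; have [[yD yY] [zD zZ]] := (y1, z1).
split=> [t u | t]; last exact: liftM.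
rewrite yD zD -!mulmxA; congr (_ *m _); rewrite !mulmxA; congr (_ *m _).
exact: (one_param_commute _ y1).
Qed.

Lemma one_param_scale c y Y : one_param lift y Y ->
  one_param lift (fun t => y (c * t)) (fun t => Y (c * t)).
Proof. by move=> [yD yY]; split=> // t u; rewrite mulrDr yD. Qed.

(** Orthogonality in both orders turns a product of root elements into a sum of nilpotent parts, the
    shape in which a Kronecker product with the identity decomposes. *)
Lemma one_param_mul_orth y z Y Z :
  one_param lift y (fun t => 1%:M + Y t) ->
  one_param lift z (fun t => 1%:M + Z t) ->
  (forall t u, Y t *m Z u = 0) -> (forall t u, Z t *m Y u = 0) ->
  one_param lift (fun t => y t *m z t) (fun t => 1%:M + (Y t + Z t)).
Proof.
move=> y1 z1 YZ ZY.
have mulYZ t u : (1%:M + Y t) *m (1%:M + Z u) = 1%:M + (Y t + Z u).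
  by rewrite mulmxDl !mulmxDr !mul1mx mulmx1 YZ addr0 addrAC addrA.
apply: (one_param_ext _ _ (one_param_mul y1 z1 _)) => [//|t|t u].
  exact: mulYZ.
by rewrite mulYZ mulmxDl !mulmxDr !mul1mx mulmx1 ZY addr0 addrA.
Qed.

Lemma one_param_big (I : eqType) (s : seq I)
    (y : I -> R -> 'M[R]_K) (Y : I -> R -> 'M[R]_N) :
  uniq s -> (forall i, one_param lift (y i) (fun t => 1%:M + Y i t)) ->
  (forall i j t u, i != j -> Y i t *m Y j u = 0) ->
  one_param lift (fun t => \big[mulmx/1%:M]_(i <- s) y i t)
                 (fun t => 1%:M + \sum_(i <- s) Y i t).
Proof.
move=> + y1 YY; elim: s => [_ | i s IHs /= /andP[i_s s_uniq]].
  apply: one_param_ext one_param1 => t; first by rewrite big_nil.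
  by rewrite big_nil addr0.
have orth j t u : j \in s -> (Y i t *m Y j u = 0) * (Y j t *m Y i u = 0).
  move=> js; have ij : i != j by apply: contraNneq i_s => ->.
  by rewrite !YY // eq_sym.
apply: (one_param_ext _ _ (one_param_mul_orth (y1 i) (IHs s_uniq) _ _)) => t.
- by rewrite big_cons.
- by rewrite big_cons.
- by move=> u; rewrite mulmx_sumr big_seq big1 // => j /orth->.
- by move=> u; rewrite mulmx_suml big_seq big1 // => j /orth->.
Qed.

(* y1, y2, y3 satisfy the relations of a Heisenberg group with center y3; its
   commutator is a biadditive function, so that its sign is trivial. *)
Lemma one_param_heisenberg c y1 y2 y3 (L1 L2 L3 E E' : 'M[R]_N) :
  c ^+ 2 = 2%:R ->
  one_param lift y1 (fun t => 1%:M + t *: L1) ->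
  one_param lift y2 (fun t => 1%:M + t *: L2) ->
  one_param lift y3 (fun t => 1%:M + t *: L3) ->
  L1 *m L2 = - E -> L2 *m L1 = - E' -> L3 = E - E' ->
  [/\ L1 *m L3 = 0, L3 *m L1 = 0, L2 *m L3 = 0 & L3 *m L2 = 0] ->
  one_param lift (fun t => y1 (c * t) *m y2 (c * t) *m y3 (t ^+ 2))
    (fun t => 1%:M + ((c * t) *: (L1 + L2) - t ^+ 2 *: (E + E'))).
Proof.
move=> c2 y1P y2P y3P L12 L21 dL3 [L13 L31 L23 L32].
have [[y1D y1L] [y2D y2L] [y3D y3L]] := And3 y1P y2P y3P.
have y3C y L : L *m L3 = 0 -> L3 *m L = 0 ->
    one_param lift y (fun t => 1%:M + t *: L) ->
    forall t u, y3 t *m y u = y u *m y3 t.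
  move=> LL3 L3L [_ yL] t u; apply: (one_param_commute _ y3P (yL u)) => v.
  rewrite !mulmxDl !mulmxDr !mul1mx !mulmx1 -!scalemxAl -!scalemxAr LL3 L3L.
  by rewrite !scaler0 !addr0 addrAC.
have y31 := y3C _ _ L13 L31 y1P; have y32 := y3C _ _ L23 L32 y2P.
have comm t u : y1 t *m y2 u = y3 (- (t * u)) *m y2 u *m y1 t.
  have [v ->] := half_sum t.
  have [||e|e] := @lift_unique (y1 v *m y2 u) (y3 (- (v * u)) *m y2 u *m y1 v)
    ((1%:M + v *: L1) *m (1%:M + u *: L2)).
  - exact: liftM.
  - have -> : (1%:M + v *: L1) *m (1%:M + u *: L2) =
        (1%:M + (- (v * u)) *: L3) *m (1%:M + u *: L2) *m (1%:M + v *: L1).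
      rewrite !(mulmxDl, mulmxDr, mul1mx, mulmx1, =^~ scalemxAl, =^~ scalemxAr).
      rewrite L12 L21 L31 L32 !(scaler0, mul0mx, addr0).
      by apply/matrixP => i j; rewrite dL3 !mxE; ring.
    by do 2!apply: liftM => //.
  - rewrite y1D -(mulmxA (y1 v)) e !mulmxA -y31 -[y3 _ *m _ *m y2 u]mulmxA e.
    by rewrite !mulmxA -y3D -!mulmxA -opprD -mulrDl.
  - rewrite y1D -(mulmxA (y1 v)) e mulmxN !mulmxA -y31.
    rewrite -[y3 _ *m _ *m y2 u]mulmxA e mulmxN mulNmx opprK.
    by rewrite !mulmxA -y3D -!mulmxA -opprD -mulrDl.
split=> [t u | t]; last first.
  have -> : 1%:M + ((c * t) *: (L1 + L2) - t ^+ 2 *: (E + E')) =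
      (1%:M + (c * t) *: L1) *m (1%:M + (c * t) *: L2) *m
        (1%:M + t ^+ 2 *: L3).
    rewrite !(mulmxDl, mulmxDr, mul1mx, mulmx1, =^~ scalemxAl, =^~ scalemxAr).
    rewrite -(mulmxA L1) L23 L13 L12 !(scaler0, mulmx0, addr0) scalerA.
    (* The first two factors contribute [-2 t^2 E], as [c ^+ 2 = 2], and the third contributes
       [t^2 (E - E')]; the total [-t^2 (E + E')] is symmetric in the two blocks. *)
    have -> : c * t * (c * t) = 2%:R * t ^+ 2 by rewrite -c2; ring.
    by apply/matrixP => i j; rewrite dL3 !mxE; ring.
  by do 2!apply: liftM => //.
rewrite mulrDr y1D y2D.
(* The cross term [2 t u] equals [(c * u) * (c * t)], which is exactly the central factor lost when
   [y2 (c * t)] is moved past [y1 (c * u)]. *)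
have -> : (t + u) ^+ 2 = (c * u) * (c * t) + (t ^+ 2 + u ^+ 2).
  by rewrite (_ : c * u * (c * t) = c ^+ 2 * t * u); [rewrite c2; ring | ring].
set a := c * u * (c * t); pose W := y1 (c * u) *m y2 (c * u).
have y3W x : y3 x *m W = W *m y3 x by rewrite mulmxA y31 -mulmxA y32 mulmxA.
transitivity (y1 (c * t) *m (y1 (c * u) *m y2 (c * t)) *m y2 (c * u) *m
   y3 (a + (t ^+ 2 + u ^+ 2))); first by rewrite !mulmxA.
transitivity (y1 (c * t) *m y2 (c * t) *m (y3 (t ^+ 2) *m W) *m y3 (u ^+ 2)).
  rewrite comm y32; transitivity (y1 (c * t) *m y2 (c * t) *m (y3 (- a) *m W) *m
    y3 (a + (t ^+ 2 + u ^+ 2))); first by rewrite !mulmxA.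
  rewrite !y3W -!mulmxA -!y3D; do 4!congr (_ *m _); congr y3; ring.
by rewrite !mulmxA.
Qed.
End OneParam.

(** * Root elements and Kronecker products *)

Section Tensor.
Variables (R : comNzRingType) (m n p q : nat).
Implicit Types (A : 'M[R]_(m, n)) (B : 'M[R]_(p, q)).

Lemma tensmxDl A A' B : (A + A') *t B = A *t B + A' *t B.
Proof. by apply/matrixP=> i j; rewrite !mxE mulrDl. Qed.

Lemma tensmxDr A B B' : A *t (B + B') = A *t B + A *t B'.
Proof. by apply/matrixP=> i j; rewrite !mxE mulrDr. Qed.

Lemma tensmxZl c A B : (c *: A) *t B = c *: (A *t B).
Proof. by apply/matrixP=> i j; rewrite !mxE mulrA. Qed.

Lemma tensmxZr c A B : A *t (c *: B) = c *: (A *t B).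
Proof. by apply/matrixP=> i j; rewrite !mxE mulrCA. Qed.

Lemma tensmxNl A B : (- A) *t B = - (A *t B).
Proof. by rewrite -scaleN1r tensmxZl scaleN1r. Qed.

Lemma tensmxNr A B : A *t (- B) = - (A *t B).
Proof. by rewrite -scaleN1r tensmxZr scaleN1r. Qed.

Lemma tensmx_suml I (s : seq I) (P : pred I) (F : I -> 'M[R]_(m, n)) B :
  (\sum_(i <- s | P i) F i) *t B = \sum_(i <- s | P i) F i *t B.
Proof.
apply: (big_morph (fun A => A *t B)) => [A A'|]; first exact: tensmxDl.
exact: tens0mx.
Qed.

Lemma tensmx_sumr I (s : seq I) (P : pred I) A (F : I -> 'M[R]_(p, q)) :
  A *t (\sum_(i <- s | P i) F i) = \sum_(i <- s | P i) A *t F i.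
Proof.
apply: (big_morph (fun B => A *t B)) => [B B'|]; first exact: tensmxDr.
exact: tensmx0.
Qed.

Lemma tensmx_delta i j k l : delta_mx i j *t delta_mx k l =
  delta_mx (mxtens_index (i, k)) (mxtens_index (j, l)) :> 'M[R]_(m * p, n * q).
Proof.
apply/matrixP=> x y; case: (mxtens_indexP x) => x1 x2.
case: (mxtens_indexP y) => y1 y2; rewrite tensmxE !mxE.
rewrite !(can_eq (@mxtens_indexK _ _)) !xpair_eqE -natrM mulnb.
by congr (nat_of_bool _)%:R; rewrite andbACA.
Qed.
End Tensor.

Lemma tensmx11 (R : comNzRingType) m n : 1%:M *t 1%:M = 1%:M :> 'M[R]_(m * n).
Proof.
apply/matrixP=> x y; case: (mxtens_indexP x) => x1 x2.
case: (mxtens_indexP y) => y1 y2; rewrite tensmxE !mxE.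
by rewrite (can_eq (@mxtens_indexK _ _)) xpair_eqE -natrM mulnb.
Qed.

(** In matrix terms, [Omega (r * s)] is the Kronecker product of [Omega r] and [Omega s]: mirror
    images are taken in both coordinates at once. *)
Lemma rev_mxtens_index r s (i : 'I_r) (k : 'I_s) :
  rev_ord (mxtens_index (i, k)) = mxtens_index (rev_ord i, rev_ord k).
Proof.
apply: val_inj => /=; have := ltn_ord i; have := ltn_ord k.
case: i k => i /= _ [k /= _] ks ir.
rewrite mulnBl mulSn; have : (i.+1 * s <= r * s)%N by rewrite leq_mul2r ir orbT.
rewrite mulSn; lia.
Qed.

Lemma mxtens_index_eq r s (p q : 'I_r * 'I_s) :
  (mxtens_index p == mxtens_index q) = (p.1 == q.1) && (p.2 == q.2).
Proof. by rewrite (can_eq (@mxtens_indexK _ _)); case: p q => [? ?] []. Qed.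

Section RootElements.
Variables (R : comUnitRingType) (N : nat).
Implicit Types (a b c d z : 'I_N).

(** The Lie algebra element spanning a long root space. Sums of roots need no separate shape: they
    are differences with [b] replaced by [rev_ord b], and negative roots exchange [a] and [b]. *)
Definition skew_delta a b : 'M[R]_N :=
  delta_mx a b - delta_mx (rev_ord b) (rev_ord a).

Definition long_root a b t : 'M[R]_N := 1%:M + t *: skew_delta a b.

Definition short_part (sqrt2 : R) a z t : 'M[R]_N :=
  (sqrt2 * t) *: (delta_mx a z - delta_mx z (rev_ord a))
  - t ^+ 2 *: delta_mx a (rev_ord a).

Definition short_root (sqrt2 : R) a z t : 'M[R]_N :=
  1%:M + short_part sqrt2 a z t.

(** Each long root space has two descriptions of opposite sign. This is where the negated parameters
    in the orthogonal formulas for long roots of the second factor come from. *)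
Lemma skew_delta_rev a b :
  skew_delta (rev_ord b) (rev_ord a) = - skew_delta a b.
Proof. by rewrite /skew_delta !rev_ordK opprB. Qed.

Lemma trmx_skew_delta a b : (skew_delta a b)^T = skew_delta b a.
Proof. by rewrite /skew_delta linearB /= !trmx_delta. Qed.

Lemma skew_delta_orth a b c d :
  b != c -> b != rev_ord d -> rev_ord a != c -> a != d ->
  skew_delta a b *m skew_delta c d = 0.
Proof.
move=> bc bd ac ad; rewrite /skew_delta mulmxBl !mulmxBr !mul_delta_mx_cond.
rewrite (negPf bc) (negPf bd) (negPf ac) (inj_eq rev_ord_inj) (negPf ad).
by rewrite !subr0.
Qed.

Lemma long_rootD a b t u : a != b -> a != rev_ord a -> b != rev_ord b ->
  long_root a b (t + u) = long_root a b t *m long_root a b u.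
Proof.
move=> ab aa bb; have LL : skew_delta a b *m skew_delta a b = 0.
  by apply: skew_delta_orth => //; rewrite eq_sym.
rewrite /long_root mulmxDl !mulmxDr !mul1mx mulmx1 -!scalemxAl -!scalemxAr LL.
by rewrite !scaler0 addr0 scalerDl -addrA (addrC (u *: _)).
Qed.

(** The linear part [M] satisfies [M *m M = - P] and [M *m P = 0], so the short root element is the
    exponential of [(sqrt2 * t) *: M], cut off after its quadratic term [- t ^+ 2 *: P]. *)
Lemma short_rootD sqrt2 a z t u : sqrt2 ^+ 2 = 2%:R ->
  a != z -> a != rev_ord a -> z = rev_ord z ->
  short_root sqrt2 a z (t + u) =
  short_root sqrt2 a z t *m short_root sqrt2 a z u.
Proof.
move=> sqrt2K az aa zz.
have raz : rev_ord a != z by rewrite zz (inj_eq rev_ord_inj).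
rewrite /short_root /short_part; set M := delta_mx a z - _; set P := delta_mx a
  (rev_ord a).
have MM : M *m M = - P.
  rewrite /M mulmxBl !mulmxBr !mul_delta_mx_cond eqxx (eq_sym z) (negPf az).
  by rewrite (negPf raz) (eq_sym _ a) (negPf aa) !subr0 sub0r.
have MP : M *m P = 0.
  rewrite /M /P mulmxBl !mul_delta_mx_cond (eq_sym z) (negPf az).
  by rewrite (eq_sym _ a) (negPf aa) subr0.
have PM : P *m M = 0.
  rewrite /M /P mulmxBr !mul_delta_mx_cond (negPf raz).
  by rewrite (eq_sym _ a) (negPf aa) subr0.
have PP : P *m P = 0 by rewrite /P mul_delta_mx_cond (eq_sym _ a) (negPf aa).
rewrite !(mulmxDl, mulmxDr, mulmxBl, mulmxBr, mul1mx, mulmx1).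
rewrite !(mulNmx, mulmxN, =^~ scalemxAl, =^~ scalemxAr, MM, MP, PM, PP).
rewrite !(scaler0, oppr0, addr0, subr0) !scalerN !scalerA.
have -> : sqrt2 * t * (sqrt2 * u) = 2%:R * t * u by rewrite -sqrt2K; ring.
by apply/matrixP=> i j; rewrite !mxE; ring.
Qed.

Lemma E_delta i j a b : i = a.+1 -> j = b.+1 -> E_ R N i j = delta_mx a b.
Proof. by move=> -> ->; apply/matrixP=> x y; rewrite !mxE. Qed.

Lemma bar_rev a : (N.+1 - a.+1)%N = (rev_ord a).+1.
Proof. by rewrite /=; have := ltn_ord a; lia. Qed.

End RootElements.

(** * Products over one half of the blocks *)

Section FoldedProducts.
Variables (R : fieldType) (K N : nat) (lift : 'M[R]_K -> 'M[R]_N -> Prop).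
Hypotheses (two0 : 2%:R != 0 :> R) (cover : sign_cover lift).
Variables (p n : nat) (w : 'I_n -> 'I_p).
Hypothesis w_val : forall k, w k = k :> nat.

Lemma sum_half_even (V : nmodType) (F : 'I_p -> V) : p = (2 * n)%N ->
  \sum_i F i = \sum_(k < n) (F (w k) + F (rev_ord (w k))).
Proof.
move=> p2n; have np : (n <= p)%N by lia.
have wE k : w k = widen_ord np k by apply: val_inj; rewrite /= w_val.
rewrite (bigID (fun i : 'I_p => (i < n)%N)) /= big_split /=; congr (_ + _).
  by rewrite (big_ord_narrow np); apply: eq_bigr => k _; rewrite wE.
rewrite (reindex_inj rev_ord_inj) /= (eq_bigl (fun i : 'I_p => (i < n)%N)).
  by rewrite (big_ord_narrow np); apply: eq_bigr => k _; rewrite wE.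
by move=> i /=; have := ltn_ord i; lia.
Qed.

Lemma sum_half_odd (V : nmodType) (F : 'I_p -> V) (mid : 'I_p) :
  p = (2 * n + 1)%N -> mid = n :> nat ->
  \sum_i F i = \sum_(k < n) (F (w k) + F (rev_ord (w k))) + F mid.
Proof.
move=> p2n midE; have np : (n <= p)%N by lia.
have wE k : w k = widen_ord np k by apply: val_inj; rewrite /= w_val.
rewrite (bigD1 mid) //= addrC; congr (_ + _).
rewrite (bigID (fun i : 'I_p => (i < n)%N)) /= big_split /=; congr (_ + _).
  rewrite (eq_bigl (fun i : 'I_p => (i < n)%N)).
    by rewrite (big_ord_narrow np); apply: eq_bigr => k _; rewrite wE.
  by move=> i; rewrite /= -val_eqE /= midE; lia.
rewrite (reindex_inj rev_ord_inj) /= (eq_bigl (fun i : 'I_p => (i < n)%N)).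
  by rewrite (big_ord_narrow np); apply: eq_bigr => k _; rewrite wE.
by move=> i /=; rewrite -val_eqE /= midE; have := ltn_ord i; lia.
Qed.

Variable D : 'I_p -> R -> 'M[R]_N.
Hypothesis D_orth : forall i j t u, i != j -> D i t *m D j u = 0.
Variable y : 'I_n -> R -> 'M[R]_K.
Hypothesis y_fold : forall k,
  one_param lift (y k) (fun t => 1%:M + (D (w k) t + D (rev_ord (w k)) t)).

Let one_param_half : (2 * n <= p)%N ->
  one_param lift (fun t => \big[mulmx/1%:M]_(k < n) y k t)
  (fun t => 1%:M + \sum_(k < n) (D (w k) t + D (rev_ord (w k)) t)).
Proof.
move=> np.
apply: (one_param_big two0 cover
  (Y := fun k t => D (w k) t + D (rev_ord (w k)) t)) => //.
  exact: index_enum_uniq.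
move=> k l t u kl; rewrite mulmxDl !mulmxDr !D_orth ?addr0 //.
all: rewrite -val_eqE /= ?w_val; move: kl; rewrite -val_eqE /=.
all: by have := ltn_ord k; have := ltn_ord l; lia.
Qed.

(** Each [y k] already fills the block of [w k] and its mirror image, so half of the indices cover
    all the blocks. *)
Lemma one_param_fold_even : p = (2 * n)%N ->
  one_param lift (fun t => \big[mulmx/1%:M]_(k < n) y k t)
  (fun t => 1%:M + \sum_i D i t).
Proof.
move=> p2n; apply: (one_param_ext _ _ (one_param_half _)) => //; last by lia.
by move=> t; rewrite sum_half_even.
Qed.

(** The middle block is its own mirror image and is left out by the pairing; it accounts for the
    separate last factor [z]. *)
Lemma one_param_fold_odd (mid : 'I_p) z :
  p = (2 * n + 1)%N -> mid = n :> nat ->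
  one_param lift z (fun t => 1%:M + D mid t) ->
  one_param lift (fun t => (\big[mulmx/1%:M]_(k < n) y k t) *m z t)
  (fun t => 1%:M + \sum_i D i t).
Proof.
move=> p2n midE z1; have np : (2 * n <= p)%N by lia.
apply: (one_param_ext _ _
  (one_param_mul_orth two0 cover (one_param_half np) z1 _ _)) => // t.
- by rewrite (sum_half_odd _ p2n midE).
- move=> u; rewrite mulmx_suml big1 // => k _.
  rewrite mulmxDl !D_orth ?addr0 // -val_eqE /= midE ?w_val;
    have := ltn_ord k; lia.
- move=> u; rewrite mulmx_sumr big1 // => k _.
  rewrite mulmxDr !D_orth ?addr0 // -val_eqE /= midE ?w_val;
    have := ltn_ord k; lia.
Qed.

End FoldedProducts.

(** * Mirror pairs of blocks *)

Section Blocks.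
Variables (R : fieldType) (N p q : nat) (e : 'I_p -> 'I_q -> 'I_N).
Hypothesis e_eq : forall i c j d, (e i c == e j d) = (i == j) && (c == d).
Hypothesis e_rev : forall i c, rev_ord (e i c) = e (rev_ord i) (rev_ord c).
Implicit Types (i j : 'I_p) (c d z : 'I_q).

(** Both terms lie in block [i], unlike those of [skew_delta (e i c) (e i d)], whose second term
    lies in block [rev_ord i]. The map [e] is kept abstract so that either Kronecker factor can
    index the blocks. *)
Definition long_block c d i t : 'M[R]_N :=
  t *: (delta_mx (e i c) (e i d)
        - delta_mx (e i (rev_ord d)) (e i (rev_ord c))).

Definition short_block (sqrt2 : R) c z i t : 'M[R]_N :=
  (sqrt2 * t) *: (delta_mx (e i c) (e i z) - delta_mx (e i z) (e i (rev_ord c)))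
  - t ^+ 2 *: delta_mx (e i c) (e i (rev_ord c)).

Let delta_orth i j c1 c2 d1 d2 : i != j ->
  delta_mx (e i c1) (e i c2) *m delta_mx (e j d1) (e j d2) = 0 :> 'M[R]_N.
Proof. by move=> ij; rewrite mul_delta_mx_cond e_eq (negPf ij). Qed.

Lemma long_block_orth c d i j t u :
  i != j -> long_block c d i t *m long_block c d j u = 0.
Proof.
move=> ij; rewrite -scalemxAl -scalemxAr mulmxBl !mulmxBr !delta_orth //.
by rewrite !subr0 !scaler0.
Qed.

Lemma short_block_orth sqrt2 c z i j t u :
  i != j -> short_block sqrt2 c z i t *m short_block sqrt2 c z j u = 0.
Proof.
move=> ij; rewrite /short_block !(mulmxBl, mulmxBr, =^~ scalemxAl, =^~ scalemxAr).
by rewrite !delta_orth // !(subr0, scaler0).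
Qed.

Lemma long_root_mid c d i t : rev_ord i = i ->
  long_root (e i c) (e i d) t = 1%:M + long_block c d i t.
Proof. by move=> ii; rewrite /long_root /skew_delta !e_rev ii. Qed.

Lemma short_root_mid sqrt2 c z i t : rev_ord i = i ->
  short_root sqrt2 (e i c) (e i z) t = 1%:M + short_block sqrt2 c z i t.
Proof. by move=> ii; rewrite /short_root /short_part !e_rev ii. Qed.

Variables (K : nat) (lift : 'M[R]_K -> 'M[R]_N -> Prop).
Hypotheses (two0 : 2%:R != 0 :> R) (cover : sign_cover lift).

(** Each of the two root elements puts one term in block [i] and one in block [rev_ord i]; together
    they supply both terms in both blocks. *)
Lemma one_param_long_pair i c d y y' :
  i != rev_ord i -> c != d -> c != rev_ord c -> d != rev_ord d ->
  one_param lift y (long_root (e i c) (e i d)) ->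
  one_param lift y' (long_root (e (rev_ord i) c) (e (rev_ord i) d)) ->
  one_param lift (fun t => y t *m y' t)
    (fun t => 1%:M + (long_block c d i t + long_block c d (rev_ord i) t)).
Proof.
move=> ii cd cc dd y1 y'1.
have ii' : rev_ord i != i by rewrite eq_sym.
have cc' : rev_ord c != c by rewrite eq_sym.
have dc : d != c by rewrite eq_sym.
have simps := (e_rev, @rev_ordK p, @rev_ordK q, e_eq, negPf ii, negPf ii', negPf
  cc, negPf cc',
  negPf dd, negPf cd, negPf dc, andbF).
apply: (one_param_ext _ _ (one_param_mul_orth two0 cover y1 y'1 _ _)) => // t.
- rewrite /skew_delta !e_rev !rev_ordK; congr (_ + _).
  by apply/matrixP=> k l; rewrite !mxE; ring.
- by move=> u; rewrite -scalemxAl -scalemxAr skew_delta_orth ?scaler0 // !simps.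
- by move=> u; rewrite -scalemxAl -scalemxAr skew_delta_orth ?scaler0 // !simps.
Qed.

(** As [z] is its own mirror image, the two long root elements meet in column [z]: their products in
    the two orders are [- E] and [- E'], in mirror blocks. The commutator is thus, up to sign, the
    third root element, whose skew part is [E - E']. *)
Lemma one_param_short_pair sqrt2 i c z y1 y2 y3 :
  sqrt2 ^+ 2 = 2%:R ->
  i != rev_ord i -> c != z -> c != rev_ord c -> z = rev_ord z ->
  one_param lift y1 (long_root (e i c) (e i z)) ->
  one_param lift y2 (long_root (e (rev_ord i) c) (e (rev_ord i) z)) ->
  one_param lift y3 (long_root (e i c) (e i (rev_ord c))) ->
  one_param lift (fun t => y1 (sqrt2 * t) *m y2 (sqrt2 * t) *m y3 (t ^+ 2))
    (fun t => 1%:M + (short_block sqrt2 c z i t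
                      + short_block sqrt2 c z (rev_ord i) t)).
Proof.
move=> sqrt2K ii cz cc zz y1P y2P y3P.
have ii' : rev_ord i != i by rewrite eq_sym.
have cc' : rev_ord c != c by rewrite eq_sym.
have zc : z != c by rewrite eq_sym.
have cz' : rev_ord c != z by rewrite zz (inj_eq rev_ord_inj).
have zc' : z != rev_ord c by rewrite eq_sym.
pose E := delta_mx (e i c) (e i (rev_ord c)) : 'M[R]_N.
pose E' := delta_mx (e (rev_ord i) c) (e (rev_ord i) (rev_ord c)) : 'M[R]_N.
have simps := (e_rev, @rev_ordK p, @rev_ordK q, esym zz, e_eq, negPf ii, negPf ii',
  negPf cc,
  negPf cc', negPf zc, negPf cz, negPf cz', negPf zc', eqxx, andbF).
apply: (one_param_ext _ _
  (one_param_heisenberg (E := E) (E' := E') two0 cover sqrt2K y1P y2P y3P _ _ _ _)).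
- by [].
- move=> t; rewrite /skew_delta /short_block /E /E' !e_rev !rev_ordK -zz.
  congr (_ + _); apply/matrixP=> k l; rewrite !mxE; ring.
- rewrite /skew_delta mulmxBl !mulmxBr !mul_delta_mx_cond !simps /=.
  by rewrite !(sub0r, oppr0, subr0, mulr0n, mulr1n).
- rewrite /skew_delta mulmxBl !mulmxBr !mul_delta_mx_cond !simps /=.
  by rewrite !(sub0r, oppr0, subr0, mulr0n, mulr1n).
- by rewrite /skew_delta !e_rev !rev_ordK.
- by split; apply: skew_delta_orth; rewrite !simps.
Qed.

End Blocks.

Section KroneckerBlocks.
Variables (R : fieldType) (r s : nat).

Definition right_index (i : 'I_r) (c : 'I_s) := mxtens_index (i, c).
Definition left_index (k : 'I_s) (a : 'I_r) := mxtens_index (a, k).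

Lemma right_index_eq i c j d :
  (right_index i c == right_index j d) = (i == j) && (c == d).
Proof. exact: mxtens_index_eq. Qed.

Lemma left_index_eq i c j d :
  (left_index i c == left_index j d) = (i == j) && (c == d).
Proof. by rewrite mxtens_index_eq andbC. Qed.

Lemma right_index_rev i c :
  rev_ord (right_index i c) = right_index (rev_ord i) (rev_ord c).
Proof. exact: rev_mxtens_index. Qed.

Lemma left_index_rev k a :
  rev_ord (left_index k a) = left_index (rev_ord k) (rev_ord a).
Proof. exact: rev_mxtens_index. Qed.

Lemma tens1mx_long_root c d (t : R) : 1%:M *t long_root c d t =
  1%:M + \sum_i long_block right_index c d i t.
Proof.
rewrite tensmxDr tensmx11; congr (_ + _).
rewrite mx1_sum_delta tensmx_suml; apply: eq_bigr => i _.
by rewrite tensmxZr tensmxDr tensmxNr !tensmx_delta.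
Qed.

Lemma tens1mx_short_root sqrt2 c z t : 1%:M *t short_root sqrt2 c z t =
  1%:M + \sum_i short_block right_index sqrt2 c z i t :> 'M[R]_(r * s).
Proof.
rewrite tensmxDr tensmx11; congr (_ + _).
rewrite mx1_sum_delta tensmx_suml; apply: eq_bigr => i _.
by rewrite !(tensmxDr, tensmxNr, tensmxZr, tensmx_delta).
Qed.

Lemma short_root_tensmx1 sqrt2 a z t : short_root sqrt2 a z t *t 1%:M =
  1%:M + \sum_k short_block left_index sqrt2 a z k t :> 'M[R]_(r * s).
Proof.
rewrite tensmxDl tensmx11; congr (_ + _).
rewrite mx1_sum_delta tensmx_sumr; apply: eq_bigr => i _.
by rewrite !(tensmxDl, tensmxNl, tensmxZl, tensmx_delta).
Qed.

Variables (K : nat) (lift : 'M[R]_K -> 'M[R]_(r * s) -> Prop).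
Hypotheses (two0 : 2%:R != 0 :> R) (cover : sign_cover lift).

Lemma one_param_long_left a b (y : 'I_s -> R -> 'M[R]_K) :
  a != b -> a != rev_ord a -> b != rev_ord b ->
  (forall k, one_param lift (y k) (long_root (left_index k a) (left_index k b))) ->
  one_param lift (fun t => \big[mulmx/1%:M]_(k < s) y k t)
    (fun t => long_root a b t *t 1%:M).
Proof.
move=> ab aa bb yP.
apply: (one_param_ext _ _ (one_param_big two0 cover (index_enum_uniq _) yP _)) => //.
  move=> t; rewrite -scaler_sumr tensmxDl tensmx11 tensmxZl; congr (_ + _ *: _).
  rewrite big_split /= sumrN tensmxDl tensmxNl !mx1_sum_delta !tensmx_sumr.
  congr (_ - _); first by apply: eq_bigr => k _; rewrite tensmx_delta.
  rewrite (reindex_inj rev_ord_inj) /=; apply: eq_bigr => k _.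
  by rewrite tensmx_delta !left_index_rev rev_ordK.
have aa' : rev_ord a != a by rewrite eq_sym.
have ba : b != a by rewrite eq_sym.
move=> k l t u kl; rewrite -scalemxAl -scalemxAr skew_delta_orth ?scaler0 //;
  by rewrite ?left_index_rev left_index_eq ?(negPf ab, negPf ba, negPf aa')
    ?(negPf bb) andbF.
Qed.

End KroneckerBlocks.

(** * Chevalley generators *)

Section SOGenerators.
Variables (R : comUnitRingType) (sqrt2 : R) (N : nat).
Implicit Types (a b z : 'I_N).

Lemma xSO_Diff e i j a b t : i = a.+1 -> j = b.+1 ->
  xSO sqrt2 N (Diff e i j) t =
  long_root (if e then b else a) (if e then a else b) t.
Proof.
move=> -> ->; rewrite /= !bar_rev !(E_delta _ erefl erefl) /long_root.
by case: e; rewrite // linearD linearZ /= trmx1 trmx_skew_delta.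
Qed.

Lemma xSO_Sum e i j a b t : i = a.+1 -> j = b.+1 ->
  xSO sqrt2 N (Sum e i j) t =
  long_root (if e then rev_ord b else a) (if e then a else rev_ord b) t.
Proof.
move=> -> ->; rewrite /= !bar_rev !(E_delta _ erefl erefl) /long_root.
have <- : skew_delta R a (rev_ord b) =
    delta_mx a (rev_ord b) - delta_mx b (rev_ord a).
  by rewrite /skew_delta rev_ordK.
by case: e; rewrite // linearD linearZ /= trmx1 trmx_skew_delta.
Qed.

(** Transposition exchanges the two linear terms, which carry opposite signs. A negative short root
    element is therefore a positive one at [rev_ord a] with negated parameter. *)
Lemma xSO_Sing e i a z t : i = a.+1 -> z = N./2 :> nat -> z = rev_ord z ->
  xSO sqrt2 N (Sing e i) t =
  short_root sqrt2 (if e then rev_ord a else a) z (if e then - t else t).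
Proof.
move=> -> zN zz; rewrite /= -zN !bar_rev !(E_delta _ erefl erefl).
rewrite /short_root /short_part; case: e.
  rewrite !linearB linearD !linearZ /= trmx1 !trmx_delta rev_ordK sqrrN.
  by apply/matrixP=> k l; rewrite !mxE; ring.
by apply/matrixP=> k l; rewrite !mxE; ring.
Qed.

End SOGenerators.

Section GeneratorLifts.
Variables (R : fieldType) (sqrt2 : R) (K N : nat).
Variables (lift : 'M[R]_K -> 'M[R]_N -> Prop) (x : root_label -> R -> 'M[R]_K).
Hypothesis x_lift :
  forall al, SO_root N al -> one_param lift (x al) (xSO sqrt2 N al).
Implicit Types (a b z : 'I_N).

Lemma lift_Diff e i j a b : i = a.+1 -> j = b.+1 -> (a < b < N./2)%N ->
  one_param lift (x (Diff e i j))
    (long_root (if e then b else a) (if e then a else b)).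
Proof.
move=> ia jb /andP[ab bN].
apply: one_param_ext (x_lift (al := Diff e i j) _) => // [t|].
  by rewrite (xSO_Diff sqrt2 e _ ia jb).
by rewrite /= ia jb; lia.
Qed.

Lemma lift_Sum e i j a b : i = a.+1 -> j = b.+1 -> (a < b < N./2)%N ->
  one_param lift (x (Sum e i j))
    (long_root (if e then rev_ord b else a) (if e then a else rev_ord b)).
Proof.
move=> ia jb /andP[ab bN].
apply: one_param_ext (x_lift (al := Sum e i j) _) => // [t|].
  by rewrite (xSO_Sum sqrt2 e _ ia jb).
by rewrite /= ia jb; lia.
Qed.

Lemma lift_Sing e i a z :
  i = a.+1 -> (a < N./2)%N -> z = N./2 :> nat -> z = rev_ord z ->
  one_param lift (x (Sing e i))
    (fun t => short_root sqrt2 (if e then rev_ord a else a) z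
                (if e then - t else t)).
Proof.
move=> ia aN zN zz.
apply: one_param_ext (x_lift (al := Sing e i) _) => // [t|].
  by rewrite (xSO_Sing sqrt2 e _ ia zN zz).
by rewrite /= ia; move/(congr1 val): zz => /=; have := ltn_ord z; lia.
Qed.

Lemma one_param_opp y (Y : R -> 'M[R]_N) : one_param lift y Y ->
  one_param lift (fun t => y (- t)) (fun t => Y (- t)).
Proof.
move=> /(one_param_scale (-1)) y1.
by apply: one_param_ext y1 => t; rewrite mulN1r.
Qed.

Lemma one_param_long_opp y a b :
  one_param lift y (long_root (rev_ord b) (rev_ord a)) ->
  one_param lift (fun t => y (- t)) (long_root a b).
Proof.
move=> /one_param_opp y1; apply: one_param_ext y1 => // t.
by rewrite /long_root skew_delta_rev scaleNr scalerN opprK.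
Qed.

End GeneratorLifts.

Lemma mid_rev N (z : 'I_N) : odd N -> z = N./2 :> nat -> z = rev_ord z.
Proof. by move=> oN zN; apply: val_inj => /=; have := ltn_ord z; lia. Qed.

Lemma half_neq_rev N (a : 'I_N) : (a < N./2)%N -> a != rev_ord a.
Proof. by move=> aN; rewrite -val_eqE /=; lia. Qed.

Lemma xSO_one_param (R : fieldType) (sqrt2 : R) d al :
  sqrt2 ^+ 2 = 2%:R -> SO_root d al ->
  one_param eq (xSO sqrt2 d al) (xSO sqrt2 d al).
Proof.
move=> sqrt2K; split=> // t u; case: al H => [e i j|e i j|e i] /=.
- case: i j => [//|i] [//|j] /andP[ij jd].
  have lt_jd : (j < d)%N by lia. have lt_id : (i < d)%N by lia.
  have := fun t => xSO_Diff sqrt2 e t (erefl : i.+1 = (Ordinal lt_id).+1) (erefl :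
    j.+1 = (Ordinal lt_jd).+1).
  move=> /= E; rewrite !E; case: e {E}; apply: long_rootD; rewrite -val_eqE /=; lia.
- case: i j => [//|i] [//|j] /andP[ij jd].
  have lt_jd : (j < d)%N by lia. have lt_id : (i < d)%N by lia.
  have := fun t => xSO_Sum sqrt2 e t (erefl : i.+1 = (Ordinal lt_id).+1) (erefl :
    j.+1 = (Ordinal lt_jd).+1).
  move=> /= E; rewrite !E; case: e {E}; apply: long_rootD; rewrite -val_eqE /=; lia.
- case: i => [/andP[]//|i] /and3P[d_odd _ id].
  have lt_id : (i < d)%N by lia. have lt_zd : (d./2 < d)%N by lia.
  have zz : Ordinal lt_zd = rev_ord (Ordinal lt_zd) by apply: mid_rev.
  have := fun t => xSO_Sing sqrt2 e t (erefl : i.+1 = (Ordinal lt_id).+1) (erefl :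
    Ordinal lt_zd = d./2 :> nat) zz.
  move=> /= E; rewrite !E; case: e {E}; rewrite ?opprD; apply: short_rootD => //;
    rewrite -val_eqE /=; lia.
Qed.

(** Indices in the first half of the left factor stay in the first half of the product, as the
    labels of roots of the large group require. *)
Lemma mxtens_index_half r s n (i : 'I_r) (c : 'I_s) :
  (2 * n <= r)%N -> (i < n)%N -> (mxtens_index (i, c) < (r * s)./2)%N.
Proof.
move=> rn lt_in; have := ltn_ord c => /= cs.
have : (i.+1 * s <= n * s)%N by rewrite leq_mul2r lt_in orbT.
have : (2 * n * s <= r * s)%N by rewrite leq_mul2r rn orbT.
rewrite mulSn /=; lia.
Qed.

Lemma mxtens_index_ltr r s (i : 'I_r) (c d : 'I_s) :
  (mxtens_index (i, c) < mxtens_index (i, d))%N = (c < d)%N.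
Proof. by rewrite /= ltn_add2l. Qed.

Lemma mxtens_index_ltl r s (i j : 'I_r) (c d : 'I_s) :
  (i < j)%N -> (mxtens_index (i, c) < mxtens_index (j, d))%N.
Proof.
move=> ij /=; have : (i.+1 * s <= j * s)%N by rewrite leq_mul2r ij orbT.
by rewrite mulSn; have := ltn_ord c; lia.
Qed.

(** * Root elements of the factors inside the large group *)

Section FactorLifts.
Variables (R : fieldType) (sqrt2 : R) (r s n : nat) (K : nat).
Hypotheses (two0 : 2%:R != 0 :> R) (sqrt2K : sqrt2 ^+ 2 = 2%:R).
Variables (lift : 'M[R]_K -> 'M[R]_(r * s) -> Prop).
Hypothesis cover : sign_cover lift.
Variable x : root_label -> R -> 'M[R]_K.
Hypothesis x_lift :
  forall al, SO_root (r * s) al -> one_param lift (x al) (xSO sqrt2 (r * s) al).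
Hypothesis rn : (2 * n <= r)%N.

Lemma lift_right_long e (i : 'I_r) (c d : 'I_s) i1 j1 i2 j2 : (i < n)%N ->
  (c < d)%N -> c != rev_ord c -> d != rev_ord d ->
  i1 = (right_index i c).+1 -> j1 = (right_index i d).+1 ->
  i2 = (right_index i (rev_ord d)).+1 -> j2 = (right_index i (rev_ord c)).+1 ->
  let c' := if e then d else c in let d' := if e then c else d in
  one_param lift
    (fun t => x (Diff e i1 j1) t *m x (Diff e i2 j2) (- t))
    (fun t => 1%:M + (long_block (@right_index r s) c' d' i t
                      + long_block (@right_index r s) c' d' (rev_ord i) t)).
Proof.
move=> lt_in cd cc dd i1E j1E i2E j2E c' d'.
have ncd : c != d by rewrite -val_eqE /= ltn_eqF.
have ii : i != rev_ord i by rewrite -val_eqE /=; lia.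
apply: (one_param_long_pair (@right_index_eq r s) (@right_index_rev r s) two0 cover);
  rewrite /c' /d' //; try by case: (e); rewrite // eq_sym.
- have := lift_Diff x_lift e i1E j1E.
  rewrite mxtens_index_ltr cd (mxtens_index_half _ rn) // => /(_ isT).
  by case: (e).
(* Block [rev_ord i] lies beyond the range of root labels; its root element is named by the mirror
   pair of indices in block [i], at the cost of a sign. *)
- apply: one_param_long_opp; rewrite !right_index_rev rev_ordK.
  have := lift_Diff x_lift e i2E j2E.
  rewrite mxtens_index_ltr (mxtens_index_half _ rn) // andbT => H.
  have {}H := H ltac:(have := ltn_ord d; rewrite /=; lia).
  by move: H; case: (e).
Qed.

(** For a negative root [c] becomes [rev_ord c] and [t] becomes [- t]. The two long factors then
    trade places, which is why they are listed in the opposite order when [e] is true. *)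
Lemma lift_right_short e (i : 'I_r) (c z : 'I_s) i1 j1 i2 j2 i3 j3 : (i < n)%N ->
  (c < z)%N -> z = rev_ord z ->
  i1 = (right_index i c).+1 -> j1 = (right_index i z).+1 ->
  i2 = (right_index i z).+1 -> j2 = (right_index i (rev_ord c)).+1 ->
  i3 = (right_index i c).+1 -> j3 = (right_index i (rev_ord c)).+1 ->
  let block t := short_block (@right_index r s) sqrt2 (if e then rev_ord c else c)
    z i t
    + short_block (@right_index r s) sqrt2 (if e then rev_ord c else c) z (rev_ord
      i) t in
  one_param lift
    (fun t => if e then x (Diff e i2 j2) (- (sqrt2 * t)) *m
                        x (Diff e i1 j1) (sqrt2 * t) *m x (Diff e i3 j3) (t ^+ 2)
              else x (Diff e i1 j1) (sqrt2 * t) *m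
                   x (Diff e i2 j2) (- (sqrt2 * t)) *m x (Diff e i3 j3) (t ^+ 2))
    (fun t => 1%:M + block (if e then - t else t)).
Proof.
move=> lt_in cz zz i1E j1E i2E j2E i3E j3E block; rewrite /block {block}.
have ii : i != rev_ord i by rewrite -val_eqE /=; lia.
have zE : z = (s - z.+1)%N :> nat by move/(congr1 val): zz.
have y1 := lift_Diff x_lift e i1E j1E; have y2 := lift_Diff x_lift e i2E j2E.
have y3 := lift_Diff x_lift e i3E j3E.
have {y1} := y1 _; rewrite mxtens_index_ltr cz (mxtens_index_half _ rn) // => /(_
  isT) y1.
have {y2} := y2 _; rewrite mxtens_index_ltr (mxtens_index_half _ rn) // andbT => y2.
have {y2} := y2 _; rewrite [(z < _)%N]/= => y2.
have {y3} := y3 _; rewrite mxtens_index_ltr (mxtens_index_half _ rn) // andbT => y3.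
have := ltn_ord z; have := ltn_ord c => cs zs.
have {}y2 := y2 ltac:(rewrite /=; lia); have {}y3 := y3 ltac:(rewrite /=; lia).
case: e y1 y2 y3 => y1 y2 y3; last first.
  apply: (one_param_short_pair (@right_index_eq r s) (@right_index_rev r s) two0 cover
    sqrt2K ii _ _ zz y1 (y2 := fun t => _ (- t)) _ y3).
  - by rewrite -val_eqE /=; lia.
  - by rewrite -val_eqE /=; lia.
  - by apply: one_param_long_opp; rewrite !right_index_rev !rev_ordK -zz; exact: y2.
apply: (one_param_ext _ _ (one_param_opp
  (one_param_short_pair (c := rev_ord c) (@right_index_eq r s) (@right_index_rev r
    s) two0 cover
    sqrt2K ii _ _ zz y2 (y2 := fun t => x (Diff true i1 j1) (- t)) _ (y3 := x (Diff
      true i3 j3)) _))).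
- by move=> t; rewrite !mulrN opprK sqrrN.
- by [].
- by rewrite -val_eqE /=; lia.
- by rewrite -val_eqE /=; lia.
- by apply: one_param_long_opp; rewrite !right_index_rev !rev_ordK -zz; exact: y1.
- by rewrite rev_ordK.
Qed.

End FactorLifts.

Section FactorFormulas.
Variables (R : fieldType) (sqrt2 : R) (r s n : nat) (K : nat).
Hypotheses (two0 : 2%:R != 0 :> R) (sqrt2K : sqrt2 ^+ 2 = 2%:R).
Variables (lift : 'M[R]_K -> 'M[R]_(r * s) -> Prop).
Hypothesis cover : sign_cover lift.
Variable x : root_label -> R -> 'M[R]_K.
Hypothesis x_lift :
  forall al, SO_root (r * s) al -> one_param lift (x al) (xSO sqrt2 (r * s) al).
Hypothesis rn : (2 * n <= r)%N.

Lemma left_Diff_formula e (a b : 'I_r) (i j : 'I_s -> nat) :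
  (a < b)%N -> (b < n)%N ->
  (forall k, i k = (mxtens_index (a, k)).+1) ->
  (forall k, j k = (mxtens_index (b, k)).+1) ->
  one_param lift (fun t => \big[mulmx/1%:M]_(k < s) x (Diff e (i k) (j k)) t)
    (fun t => xSO sqrt2 r (Diff e a.+1 b.+1) t *t 1%:M).
Proof.
move=> ab bn iE jE; have ab' : a != b by rewrite -val_eqE /= ltn_eqF.
have aa : a != rev_ord a by apply: half_neq_rev; lia.
have bb : b != rev_ord b by apply: half_neq_rev; lia.
have L := one_param_long_left two0 cover
  (a := if e then b else a) (b := if e then a else b).
apply: one_param_ext (L (fun k => x (Diff e (i k) (j k))) _ _ _ _) => //.
- by move=> t; rewrite (xSO_Diff sqrt2 e _ (erefl a.+1) (erefl b.+1)).
- by case: (e); rewrite // eq_sym.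
- by case: (e).
- by case: (e).
move=> k; have := lift_Diff x_lift e (iE k) (jE k).
by rewrite mxtens_index_ltl // (mxtens_index_half _ rn) // => /(_ isT); case: (e).
Qed.

(** The index [(rev_ord b, k)] is the mirror image of [(b, rev_ord k)], so the second root label has
    its column reversed. *)
Lemma left_Sum_formula e (a b : 'I_r) (i j : 'I_s -> nat) :
  (a < b)%N -> (b < n)%N ->
  (forall k, i k = (mxtens_index (a, k)).+1) ->
  (forall k, j k = (mxtens_index (b, rev_ord k)).+1) ->
  one_param lift (fun t => \big[mulmx/1%:M]_(k < s) x (Sum e (i k) (j k)) t)
    (fun t => xSO sqrt2 r (Sum e a.+1 b.+1) t *t 1%:M).
Proof.
move=> ab bn iE jE; have ab' : a != rev_ord b by rewrite -val_eqE /=; lia.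
have aa : a != rev_ord a by apply: half_neq_rev; lia.
have bb : rev_ord b != b by rewrite eq_sym; apply: half_neq_rev; lia.
have L := one_param_long_left two0 cover
  (a := if e then rev_ord b else a) (b := if e then a else rev_ord b).
apply: one_param_ext (L (fun k => x (Sum e (i k) (j k))) _ _ _ _) => //.
- by move=> t; rewrite (xSO_Sum sqrt2 e _ (erefl a.+1) (erefl b.+1)).
- by case: (e); rewrite // eq_sym.
- by case: (e); rewrite ?rev_ordK.
- by case: (e); rewrite ?rev_ordK.
move=> k; have := lift_Sum x_lift e (iE k) (jE k).
rewrite mxtens_index_ltl // (mxtens_index_half _ rn) // => /(_ isT).
by rewrite rev_mxtens_index rev_ordK; case: (e).
Qed.

Let w (k : 'I_n) : 'I_r := widen_ord (leq_trans (leq_pmull n (isT : 0 < 2)%N) rn) k.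

Section RightLong.
Variables (e : bool) (c d : 'I_s) (i1 j1 i2 j2 : 'I_n -> nat).
Hypotheses (cd : (c < d)%N) (cc : c != rev_ord c) (dd : d != rev_ord d).
Hypothesis i1E : forall k, i1 k = (right_index (w k) c).+1.
Hypothesis j1E : forall k, j1 k = (right_index (w k) d).+1.
Hypothesis i2E : forall k, i2 k = (right_index (w k) (rev_ord d)).+1.
Hypothesis j2E : forall k, j2 k = (right_index (w k) (rev_ord c)).+1.

Let c' := if e then d else c.
Let d' := if e then c else d.
Let y k t := x (Diff e (i1 k) (j1 k)) t *m x (Diff e (i2 k) (j2 k)) (- t).

Let y_fold k : one_param lift (y k)
  (fun t => 1%:M + (long_block (@right_index r s) c' d' (w k) t
                    + long_block (@right_index r s) c' d' (rev_ord (w k)) t)).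
Proof. by apply: (lift_right_long two0 cover x_lift rn) => //=. Qed.

Lemma right_long_even : r = (2 * n)%N ->
  one_param lift (fun t => \big[mulmx/1%:M]_(k < n) y k t)
    (fun t => 1%:M *t long_root c' d' t).
Proof.
move=> r2n; apply: (one_param_ext _ _ (one_param_fold_even two0 cover
  (w := w) _ (long_block_orth (@right_index_eq r s) _ _) y_fold r2n)) => // t.
by rewrite tens1mx_long_root.
Qed.

Lemma right_long_odd (mid : 'I_r) z : r = (2 * n + 1)%N -> mid = n :> nat ->
  one_param lift z (long_root (right_index mid c') (right_index mid d')) ->
  one_param lift (fun t => (\big[mulmx/1%:M]_(k < n) y k t) *m z t)
    (fun t => 1%:M *t long_root c' d' t).
Proof.
move=> r2n midE z1; have mid_rev : rev_ord mid = mid.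
  by apply: val_inj; rewrite /= midE; lia.
apply: (one_param_ext _ _ (one_param_fold_odd two0 cover
  (w := w) _ (long_block_orth (@right_index_eq r s) _ _) y_fold r2n midE _)) => //.
  by move=> t; rewrite tens1mx_long_root.
apply: one_param_ext z1 => // t.
exact: (long_root_mid (@right_index_rev r s)).
Qed.
End RightLong.

Section RightShort.
Variables (e : bool) (c z : 'I_s) (i1 i2 i3 : 'I_n -> nat).
Hypotheses (cz : (c < z)%N) (zz : z = rev_ord z).
Hypothesis i1E : forall k, i1 k = (right_index (w k) c).+1.
Hypothesis i2E : forall k, i2 k = (right_index (w k) z).+1.
Hypothesis i3E : forall k, i3 k = (right_index (w k) (rev_ord c)).+1.

Let c' := if e then rev_ord c else c.
Let y k t :=
  if e then x (Diff e (i2 k) (i3 k)) (- (sqrt2 * t)) *m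
            x (Diff e (i1 k) (i2 k)) (sqrt2 * t) *m x (Diff e (i1 k) (i3 k)) (t ^+ 2)
  else x (Diff e (i1 k) (i2 k)) (sqrt2 * t) *m
       x (Diff e (i2 k) (i3 k)) (- (sqrt2 * t)) *m x (Diff e (i1 k) (i3 k)) (t ^+ 2).
Let sgn t : R := if e then - t else t.

Let y_fold k : one_param lift (y k)
  (fun t => 1%:M + (short_block (@right_index r s) sqrt2 c' z (w k) (sgn t)
     + short_block (@right_index r s) sqrt2 c' z (rev_ord (w k)) (sgn t))).
Proof. by apply: (lift_right_short two0 sqrt2K cover x_lift rn) => //=. Qed.

Lemma right_short_even : r = (2 * n)%N ->
  one_param lift (fun t => \big[mulmx/1%:M]_(k < n) y k t)
    (fun t => 1%:M *t short_root sqrt2 c' z (sgn t)).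
Proof.
move=> r2n; apply: (one_param_ext _ _ (one_param_fold_even two0 cover
  (w := w) (D := fun i t => short_block (@right_index r s) sqrt2 c' z i (sgn t))
  _ _ y_fold r2n)) => // [t | i j t u].
  by rewrite tens1mx_short_root.
exact: (short_block_orth (@right_index_eq r s)).
Qed.

Lemma right_short_odd (mid : 'I_r) v : r = (2 * n + 1)%N -> mid = n :> nat ->
  one_param lift v (fun t =>
    short_root sqrt2 (right_index mid c') (right_index mid z) (sgn t)) ->
  one_param lift (fun t => (\big[mulmx/1%:M]_(k < n) y k t) *m v t)
    (fun t => 1%:M *t short_root sqrt2 c' z (sgn t)).
Proof.
move=> r2n midE v1; have mid_rev : rev_ord mid = mid.
  by apply: val_inj; rewrite /= midE; lia.
apply: (one_param_ext _ _ (one_param_fold_odd two0 cover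
  (w := w) (D := fun i t => short_block (@right_index r s) sqrt2 c' z i (sgn t))
  _ _ y_fold r2n midE _)) => // [t | i j t u |].
- by rewrite tens1mx_short_root.
- exact: (short_block_orth (@right_index_eq r s)).
apply: one_param_ext v1 => // t.
exact: (short_root_mid (@right_index_rev r s)).
Qed.
End RightShort.

End FactorFormulas.

(** * The formulas with an even orthogonal first factor *)

Section EvenFormulas.
Variables (R : fieldType) (sqrt2 : R) (n s K p q : nat).
Hypotheses (two0 : 2%:R != 0 :> R) (sqrt2K : sqrt2 ^+ 2 = 2%:R).
Variables (lift : 'M[R]_K -> 'M[R]_(2 * n * s) -> Prop).
Hypothesis cover : sign_cover lift.
Variables (x1 : root_label -> R -> 'M[R]_p) (x2 : root_label -> R -> 'M[R]_q).
Variables (x : root_label -> R -> 'M[R]_K) (f : 'M[R]_p -> 'M[R]_q -> 'M[R]_K).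
Hypothesis x_lift : forall al, SO_root (2 * n * s) al ->
  one_param lift (x al) (xSO sqrt2 (2 * n * s) al).
Hypothesis x1_lift : forall al, SO_root (2 * n) al ->
  one_param lift (fun t => f (x1 al t) 1%:M)
    (fun t => xSO sqrt2 (2 * n) al t *t 1%:M).
Hypothesis x2_lift : forall al, SO_root s al ->
  one_param lift (fun t => f 1%:M (x2 al t))
    (fun t => 1%:M *t xSO sqrt2 s al t).

Lemma even_formulas : formulas_SO_even sqrt2 n s x1 x2 x f.
Proof.
split; [|split].
- move=> e t [//|i] [//|j] _ ij jn; rewrite !subn1 !big_add1 !big_mkord.
  have lt_i : (i < 2 * n)%N by lia. have lt_j : (j < 2 * n)%N by lia.
  pose a := Ordinal lt_i; pose b := Ordinal lt_j.
  split; move: t.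
  + apply: (one_param_unique two0 cover (x1_lift (al := Diff e i.+1 j.+1) _)).
      by rewrite /=; lia.
    by apply: (left_Diff_formula two0 cover x_lift (leqnn _) e (a := a) (b := b))
      => // k; rewrite /= mulnC addnS.
  + apply: (one_param_unique two0 cover (x1_lift (al := Sum e i.+1 j.+1) _)).
      by rewrite /=; lia.
    apply: (left_Sum_formula two0 cover x_lift (leqnn _) e (a := a) (b := b))
      => // k; rewrite /= mulnC ?addnS //.
    by have := ltn_ord k; lia.
- move=> e u [//|i] [//|j] _ ij jm; rewrite !big_mkord.
  have lt_i : (i < s)%N by lia. have lt_j : (j < s)%N by lia.
  pose a := Ordinal lt_i; pose b := Ordinal lt_j.
  split; move: u.
  + apply: (one_param_unique two0 cover (x2_lift (al := Diff e i.+1 j.+1) _)).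
      by rewrite /=; lia.
    apply: (one_param_ext _ _ (right_long_even two0 cover x_lift (rn := leqnn _)
      e (c := a) (d := b) _ _ _ _ _ _ _ erefl)) => //.
    * by move=> t; rewrite (xSO_Diff sqrt2 e t (erefl a.+1) (erefl b.+1)).
    * by apply: half_neq_rev => /=; lia.
    * by apply: half_neq_rev => /=; lia.
    * by move=> k; rewrite /= mulnC addnS.
    * by move=> k; rewrite /= mulnC addnS.
    * by move=> k; rewrite /= mulnC; lia.
    * by move=> k; rewrite /= mulnC; lia.
  + apply: (one_param_unique two0 cover (x2_lift (al := Sum e i.+1 j.+1) _)).
      by rewrite /=; lia.
    (* With [rev_ord b] in place of [b] a sum of roots becomes a difference of indices, and the
       folding argument for differences applies. *)
    apply: (one_param_ext _ _ (right_long_even two0 cover x_lift (rn := leqnn _)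
      e (c := a) (d := rev_ord b) _ _ _ _ _ _ _ erefl)) => //.
    * by move=> t; rewrite (xSO_Sum sqrt2 e t (erefl a.+1) (erefl b.+1)).
    * by rewrite /=; lia.
    * by apply: half_neq_rev => /=; lia.
    * by rewrite rev_ordK eq_sym; apply: half_neq_rev => /=; lia.
    * by move=> k; rewrite /= mulnC addnS.
    * by move=> k; rewrite /= mulnC; lia.
    * by move=> k; rewrite rev_ordK /= mulnC addnS.
    * by move=> k; rewrite /= mulnC; lia.
- move=> s_odd u [//|i] _ im; rewrite !big_mkord.
  have lt_i : (i < s)%N by lia. have lt_z : (s./2 < s)%N by lia.
  pose a := Ordinal lt_i; pose z := Ordinal lt_z.
  have zz : z = rev_ord z by apply: mid_rev.
  split; move: u.
  + apply: (one_param_unique two0 cover (x2_lift (al := Sing false i.+1) _)).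
      by rewrite /= s_odd.
    apply: (one_param_ext _ _ (right_short_even two0 sqrt2K cover x_lift (rn :=
      leqnn _)
      false (c := a) (z := z) _ zz _ _ _ erefl)) => //.
    * by move=> t; rewrite (xSO_Sing sqrt2 false t (erefl a.+1) (erefl : z = s./2
      :> nat) zz).
    * by move=> k; rewrite /= mulnC addnS.
    * by move=> k; rewrite /= mulnC addn1.
    * by move=> k; rewrite /= mulnC; lia.
  + apply: (one_param_unique two0 cover (x2_lift (al := Sing true i.+1) _)).
      by rewrite /= s_odd.
    apply: (one_param_ext _ _ (right_short_even two0 sqrt2K cover x_lift (rn :=
      leqnn _)
      true (c := a) (z := z) _ zz _ _ _ erefl)) => //.
    * by move=> t; rewrite (xSO_Sing sqrt2 true t (erefl a.+1) (erefl : z = s./2 :>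
      nat) zz).
    * by move=> k; rewrite /= mulnC addnS.
    * by move=> k; rewrite /= mulnC addn1.
    * by move=> k; rewrite /= mulnC; lia.
Qed.
End EvenFormulas.

(** * The formulas for two odd orthogonal factors *)

Section OddFormulas.
Variables (R : fieldType) (sqrt2 : R) (n m K p q : nat).
Hypotheses (two0 : 2%:R != 0 :> R) (sqrt2K : sqrt2 ^+ 2 = 2%:R).
Local Notation r := (2 * n + 1)%N.
Local Notation s := (2 * m + 1)%N.
Variables (lift : 'M[R]_K -> 'M[R]_(r * s) -> Prop).
Hypothesis cover : sign_cover lift.
Variables (x1 : root_label -> R -> 'M[R]_p) (x2 : root_label -> R -> 'M[R]_q).
Variables (x : root_label -> R -> 'M[R]_K) (f : 'M[R]_p -> 'M[R]_q -> 'M[R]_K).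
Hypothesis x_lift : forall al, SO_root (r * s) al ->
  one_param lift (x al) (xSO sqrt2 (r * s) al).
Hypothesis x1_lift : forall al, SO_root r al ->
  one_param lift (fun t => f (x1 al t) 1%:M)
    (fun t => xSO sqrt2 r al t *t 1%:M).
Hypothesis x2_lift : forall al, SO_root s al ->
  one_param lift (fun t => f 1%:M (x2 al t))
    (fun t => 1%:M *t xSO sqrt2 s al t).

Let rn : (2 * n <= r)%N. Proof. by lia. Qed.
Let sm : (2 * m <= s)%N. Proof. by lia. Qed.
Let half_rs : ((r * s)./2 = n * s + m)%N. Proof. by nia. Qed.
Let lt_mid_r : (n < r)%N. Proof. by lia. Qed.
Let lt_mid_s : (m < s)%N. Proof. by lia. Qed.
Let mid_r : 'I_r := Ordinal lt_mid_r.
Let mid_s : 'I_s := Ordinal lt_mid_s.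
Let mid : 'I_(r * s) := mxtens_index (mid_r, mid_s).

Let mid_r_rev : rev_ord mid_r = mid_r.
Proof. by apply: val_inj => /=; lia. Qed.

Let mid_s_rev : rev_ord mid_s = mid_s.
Proof. by apply: val_inj => /=; lia. Qed.

Let mid_half : mid = (r * s)./2 :> nat. Proof. by rewrite half_rs. Qed.

Let mid_rev : mid = rev_ord mid.
Proof. by rewrite rev_mxtens_index mid_r_rev mid_s_rev. Qed.

Let mid_s_half : mid_s = s./2 :> nat. Proof. by rewrite /=; lia. Qed.

Let w (k : 'I_m) : 'I_s := widen_ord (leq_trans (leq_pmull m (isT : 0 < 2)%N) sm) k.

(** The blocks are now indexed by the second factor, and the middle index [mid_r] of the first
    factor is the one where a mirror pair meets. The partner of a block is reached through a sum of
    roots, so no parameter changes sign; the middle block [mid_s] gives the short root factor at the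
    end. *)
Let left_short e (a : 'I_r) (i1 i2 i3 : 'I_m -> nat) i4 : (a < n)%N ->
  (forall k, i1 k = (left_index (w k) a).+1) ->
  (forall k, i2 k = (left_index (w k) mid_r).+1) ->
  (forall k, i3 k = (left_index (rev_ord (w k)) a).+1) ->
  i4 = (left_index mid_s a).+1 ->
  one_param lift
    (fun t => (\big[mulmx/1%:M]_(k < m)
       ((if e then x (Sum e (i3 k) (i2 k)) (sqrt2 * t) *m
                   x (Diff e (i1 k) (i2 k)) (sqrt2 * t)
         else x (Diff e (i1 k) (i2 k)) (sqrt2 * t) *m
              x (Sum e (i3 k) (i2 k)) (sqrt2 * t)) *m
        x (Sum e (i1 k) (i3 k)) (t ^+ 2))) *m x (Sing e i4) t)
    (fun t => xSO sqrt2 r (Sing e a.+1) t *t 1%:M).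
Proof.
move=> an i1E i2E i3E i4E.
have lt_w k : (w k < m)%N by rewrite /=.
have mid_r_half : mid_r = r./2 :> nat by rewrite /=; lia.
have amid : a != mid_r by rewrite -val_eqE /=; lia.
have aa : a != rev_ord a by apply: half_neq_rev; lia.
have lt13 k : (left_index (w k) a < left_index (rev_ord (w k)) a < (r * s)./2)%N.
  by rewrite mxtens_index_ltr (mxtens_index_half _ rn an) /=; have := ltn_ord k; lia.
have lt12 k (c : 'I_s) : (left_index c a < left_index (w k) mid_r < (r * s)./2)%N.
  apply/andP; split; first exact: mxtens_index_ltl.
  by rewrite half_rs /= ltn_add2l.
pose a' := if e then rev_ord a else a.
pose sgn t : R := if e then - t else t.
(* This is the product in the parameter of the short root element at [a']. For a negative root that
   parameter is [- t], and substituting [sgn t] restores the signs of the statement. *)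
pose y k t := (if e then x (Sum e (i3 k) (i2 k)) (- (sqrt2 * t)) *m
                      x (Diff e (i1 k) (i2 k)) (- (sqrt2 * t))
         else x (Diff e (i1 k) (i2 k)) (sqrt2 * t) *m
              x (Sum e (i3 k) (i2 k)) (sqrt2 * t)) *m
        x (Sum e (i1 k) (i3 k)) (t ^+ 2).
have y_fold k : one_param lift (y k) (fun t => 1%:M +
    (short_block (@left_index r s) sqrt2 a' mid_r (w k) t
     + short_block (@left_index r s) sqrt2 a' mid_r (rev_ord (w k)) t)).
  have y1 := lift_Diff x_lift e (i1E k) (i2E k) (lt12 _ _).
  have y2 := lift_Sum x_lift e (i3E k) (i2E k) (lt12 _ _).
  have y3 := lift_Sum x_lift e (i1E k) (i3E k) (lt13 _).
  have ww : w k != rev_ord (w k) by apply: half_neq_rev => /=; have := ltn_ord k; lia.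
  rewrite /y /a'; case: (e) y1 y2 y3 => y1 y2 y3.
    apply: (one_param_short_pair (@left_index_eq r s) (@left_index_rev r s) two0 cover
      sqrt2K ww _ _ _ (y1 := fun t => _ (- t)) (y2 := fun t => _ (- t)) _ _ _).
    + by rewrite -mid_r_rev (inj_eq rev_ord_inj).
    + by rewrite rev_ordK eq_sym.
    + by [].
    + apply: one_param_long_opp; rewrite !left_index_rev rev_ordK mid_r_rev.
      by rewrite left_index_rev mid_r_rev in y2; exact: y2.
    + apply: one_param_long_opp; rewrite !left_index_rev !rev_ordK mid_r_rev.
      exact: y1.
    + by rewrite left_index_rev !rev_ordK in y3; rewrite rev_ordK; exact: y3.
  apply: (one_param_short_pair (@left_index_eq r s) (@left_index_rev r s) two0 cover
    sqrt2K ww amid aa _ y1 _ _) => //.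
  + by rewrite left_index_rev mid_r_rev in y2; exact: y2.
  + by rewrite left_index_rev rev_ordK in y3; exact: y3.
pose v t := x (Sing e i4) (sgn t).
have v_lift : one_param lift v
    (fun t => 1%:M + short_block (@left_index r s) sqrt2 a' mid_r mid_s t).
  have := lift_Sing x_lift e i4E (mxtens_index_half _ rn an) mid_half mid_rev.
  rewrite /v /sgn /a'; case: (e) => v1.
    apply: one_param_ext (one_param_opp v1) => // t.
    rewrite opprK left_index_rev mid_s_rev.
    exact: (short_root_mid (@left_index_rev r s)).
  apply: one_param_ext v1 => // t.
  exact: (short_root_mid (@left_index_rev r s)).
have H := one_param_fold_odd two0 cover (w := w) (fun k => erefl)
  (fun i j t u => @short_block_orth _ _ _ _ _ (@left_index_eq r s) _ _ _ i j t u)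
  y_fold erefl (erefl : mid_s = m :> nat) v_lift.
have {}H : one_param lift
    (fun t => \big[mulmx/1%:M]_(k < m) y k (sgn t) *m v (sgn t))
    (fun t => short_root sqrt2 a' mid_r (sgn t) *t 1%:M).
  rewrite /sgn; case: (e) (H) => {}H.
    by apply: one_param_ext (one_param_opp H) => // t; rewrite short_root_tensmx1.
  by apply: one_param_ext H => // t; rewrite short_root_tensmx1.
apply: one_param_ext H => t.
  rewrite /v /sgn /y; case: (e); rewrite ?opprK //.
  by congr (_ *m _); apply: eq_bigr => k _; rewrite mulrN opprK sqrrN.
by rewrite (xSO_Sing sqrt2 e t (erefl a.+1) mid_r_half).
Qed.

Lemma odd_formulas : formulas_SO_odd sqrt2 n m x1 x2 x f.
Proof.
split; [|split; [|split]].
- move=> e t [//|i] [//|j] _ ij jn; rewrite !subn1 !big_add1 !big_mkord.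
  have lt_i : (i < r)%N by lia. have lt_j : (j < r)%N by lia.
  pose a := Ordinal lt_i; pose b := Ordinal lt_j.
  split; move: t.
  + apply: (one_param_unique two0 cover (x1_lift (al := Diff e i.+1 j.+1) _)).
      by rewrite /=; lia.
    by apply: (left_Diff_formula two0 cover x_lift rn e (a := a) (b := b))
      => // k; rewrite /= mulnC addnS.
  + apply: (one_param_unique two0 cover (x1_lift (al := Sum e i.+1 j.+1) _)).
      by rewrite /=; lia.
    apply: (left_Sum_formula two0 cover x_lift rn e (a := a) (b := b))
      => // k; rewrite /= mulnC ?addnS //.
    by have := ltn_ord k; lia.
- move=> t [//|i] _ i_n; rewrite !subn1 !big_add1 !big_mkord.
  have lt_i : (i < r)%N by lia.
  pose a := Ordinal lt_i.
  split; move: t.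
  + apply: (one_param_unique two0 cover (x1_lift (al := Sing false i.+1) _)).
      by rewrite /=; lia.
    apply: (left_short false (a := a)) => //.
    * by move=> k; rewrite /= mulnC addnS.
    * by move=> k; rewrite /= mulnC addnS.
    * by move=> k; rewrite /= mulnC; have := ltn_ord k; lia.
    * by rewrite /= mulnC addn1.
  + apply: (one_param_unique two0 cover (x1_lift (al := Sing true i.+1) _)).
      by rewrite /=; lia.
    apply: (left_short true (a := a)) => //.
    * by move=> k; rewrite /= mulnC addnS.
    * by move=> k; rewrite /= mulnC addnS.
    * by move=> k; rewrite /= mulnC; have := ltn_ord k; lia.
    * by rewrite /= mulnC addn1.
- move=> e u [//|i] [//|j] _ ij jm; rewrite !big_mkord.
  have lt_i : (i < s)%N by lia. have lt_j : (j < s)%N by lia.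
  pose a := Ordinal lt_i; pose b := Ordinal lt_j.
  have mid_lt (c : 'I_s) : (c < m)%N -> (right_index mid_r c < (r * s)./2)%N.
    by move=> cm; rewrite half_rs /= ltn_add2l.
  have mid_a : (s * n + i.+1)%N = (right_index mid_r a).+1.
    by rewrite /= mulnC addnS.
  have mid_b : (s * n + j.+1)%N = (right_index mid_r b).+1.
    by rewrite /= mulnC addnS.
  have lt_ab : (right_index mid_r a < right_index mid_r b < (r * s)./2)%N.
    by rewrite mxtens_index_ltr mid_lt // andbT.
  split; move: u.
  + apply: (one_param_unique two0 cover (x2_lift (al := Diff e i.+1 j.+1) _)).
      by rewrite /=; lia.
    apply: (one_param_ext _ _ (right_long_odd two0 cover x_lift (rn := rn)
      (e := e) (c := a) (d := b) _ _ _ _ _ _ _ (mid := mid_r) erefl _ _)) => //.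
    * by move=> t; rewrite (xSO_Diff sqrt2 e t (erefl a.+1) (erefl b.+1)).
    * by apply: half_neq_rev => /=; lia.
    * by apply: half_neq_rev => /=; lia.
    * by move=> k; rewrite /= mulnC addnS.
    * by move=> k; rewrite /= mulnC addnS.
    * by move=> k; rewrite /= mulnC; lia.
    * by move=> k; rewrite /= mulnC; lia.
    * by have := lift_Diff x_lift e mid_a mid_b lt_ab; case: (e).
  + apply: (one_param_unique two0 cover (x2_lift (al := Sum e i.+1 j.+1) _)).
      by rewrite /=; lia.
    apply: (one_param_ext _ _ (right_long_odd two0 cover x_lift (rn := rn)
      (e := e) (c := a) (d := rev_ord b) _ _ _ _ _ _ _ (mid := mid_r) erefl _ _))
        => //.
    * by move=> t; rewrite (xSO_Sum sqrt2 e t (erefl a.+1) (erefl b.+1)).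
    * by rewrite /=; lia.
    * by apply: half_neq_rev => /=; lia.
    * by rewrite rev_ordK eq_sym; apply: half_neq_rev => /=; lia.
    * by move=> k; rewrite /= mulnC addnS.
    * by move=> k; rewrite /= mulnC; lia.
    * by move=> k; rewrite rev_ordK /= mulnC addnS.
    * by move=> k; rewrite /= mulnC; lia.
    (* In the self-mirrored row [(mid_r, rev_ord b)] is the mirror image of [(mid_r, b)], so the
       last factor carries a sum of roots where the other rows carry differences. *)
    * have := lift_Sum x_lift e mid_a mid_b lt_ab.
      by rewrite right_index_rev mid_r_rev; case: (e).
- move=> u [//|i] _ im; rewrite !big_mkord.
  have lt_i : (i < s)%N by lia.
  pose a := Ordinal lt_i.
  have mid_a : (s * n + i.+1)%N = (right_index mid_r a).+1.
    by rewrite /= mulnC addnS.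
  have lt_a : (right_index mid_r a < (r * s)./2)%N by rewrite half_rs /= ltn_add2l.
  split; move: u.
  + apply: (one_param_unique two0 cover (x2_lift (al := Sing false i.+1) _)).
      by rewrite /=; lia.
    apply: (one_param_ext _ _ (right_short_odd two0 sqrt2K cover x_lift (rn := rn)
      (e := false) (c := a) (z := mid_s) _ (esym mid_s_rev) _ _ _ (mid := mid_r)
        erefl _ _)) => //.
    * by move=> t; rewrite (xSO_Sing sqrt2 false t (erefl a.+1) mid_s_half (esym
      mid_s_rev)).
    * by move=> k; rewrite /= mulnC addnS.
    * by move=> k; rewrite /= mulnC addn1.
    * by move=> k; rewrite /= mulnC; lia.
    * exact: (lift_Sing x_lift false mid_a lt_a mid_half mid_rev).
  + apply: (one_param_unique two0 cover (x2_lift (al := Sing true i.+1) _)).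
      by rewrite /=; lia.
    apply: (one_param_ext _ _ (right_short_odd two0 sqrt2K cover x_lift (rn := rn)
      (e := true) (c := a) (z := mid_s) _ (esym mid_s_rev) _ _ _ (mid := mid_r)
        erefl _ _)) => //.
    * by move=> t; rewrite (xSO_Sing sqrt2 true t (erefl a.+1) mid_s_half (esym
      mid_s_rev)).
    * by move=> k; rewrite /= mulnC addnS.
    * by move=> k; rewrite /= mulnC addn1.
    * by move=> k; rewrite /= mulnC; lia.
    * have := lift_Sing x_lift true mid_a lt_a mid_half mid_rev.
      by rewrite right_index_rev mid_r_rev.
Qed.

End OddFormulas.

(** * The symplectic case *)

(** Generators for negative roots are the transposes of those for positive ones; keeping the
    transposition as a flag treats both signs in one computation. *)
Definition trmx_if (R : Type) n (e : bool) (M : 'M[R]_n) : 'M[R]_n :=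
  if e then M^T else M.

Lemma trmx_ifD (R : nzRingType) n e (A B : 'M[R]_n) :
  trmx_if e (A + B) = trmx_if e A + trmx_if e B.
Proof. by case: e; rewrite /= ?linearD. Qed.

Lemma trmx_ifN (R : nzRingType) n e (A : 'M[R]_n) :
  trmx_if e (- A) = - trmx_if e A.
Proof. by case: e; rewrite /= ?linearN. Qed.

Lemma trmx_ifZ (R : nzRingType) n e c (A : 'M[R]_n) :
  trmx_if e (c *: A) = c *: trmx_if e A.
Proof. by case: e; rewrite /= ?linearZ. Qed.

Lemma trmx_if1 (R : nzRingType) n e : trmx_if e 1%:M = 1%:M :> 'M[R]_n.
Proof. by case: e; rewrite /= ?trmx1. Qed.

Lemma trmx_if_sum (R : nzRingType) n e I (s : seq I) (F : I -> 'M[R]_n) :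
  trmx_if e (\sum_(i <- s) F i) = \sum_(i <- s) trmx_if e (F i).
Proof. by case: e; rewrite /= ?linear_sum. Qed.

Lemma trmx_if_orth (R : comNzRingType) n e (A B : 'M[R]_n) :
  A *m B = 0 -> B *m A = 0 -> trmx_if e A *m trmx_if e B = 0.
Proof. by move=> AB BA; case: e; rewrite //= -trmx_mul BA trmx0. Qed.

Lemma long_root_trmx_if (R : comUnitRingType) N e (a b : 'I_N) (t : R) :
  long_root (if e then b else a) (if e then a else b) t =
  1%:M + t *: trmx_if e (skew_delta R a b).
Proof. by case: e; rewrite /long_root //= trmx_skew_delta. Qed.

Section SymplecticBlocks.
Variable R : comUnitRingType.

Lemma Omega_sqr d : Omega R d *m Omega R d = 1%:M.
Proof.
apply/matrixP=> i j; rewrite !mxE (bigD1 (rev_ord i)) //= big1 => [|k /negbTE ki].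
  by rewrite !mxE eqxx mul1r addr0 rev_ordK eq_sym.
by rewrite !mxE ki mul0r.
Qed.

Lemma trmx_Omega d : (Omega R d)^T = Omega R d.
Proof.
apply/matrixP=> i j; rewrite !mxE eq_sym.
by rewrite (can2_eq (@rev_ordK _) (@rev_ordK _)).
Qed.

Lemma Omega_delta d p (i : 'I_d) (j : 'I_p) :
  Omega R d *m delta_mx i j = delta_mx (rev_ord i) j.
Proof.
apply/matrixP=> k l; rewrite !mxE (bigD1 i) //= big1 => [|z /negbTE zi].
  rewrite !mxE eqxx addr0 -natrM mulnb; congr (nat_of_bool (_ && _))%:R.
  by rewrite eq_sym (can2_eq (@rev_ordK _) (@rev_ordK _)).
by rewrite !mxE zi mulr0.
Qed.

Lemma delta_Omega d p (i : 'I_p) (j : 'I_d) :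
  delta_mx i j *m Omega R d = delta_mx i (rev_ord j).
Proof. by apply: trmx_inj; rewrite trmx_mul !trmx_delta trmx_Omega Omega_delta. Qed.

Lemma rev_lshift m (i : 'I_m) : rev_ord (lshift m i) = rshift m (rev_ord i).
Proof. by apply: val_inj => /=; have := ltn_ord i; lia. Qed.

Lemma rev_rshift m (i : 'I_m) : rev_ord (rshift m i) = lshift m (rev_ord i).
Proof. by apply: val_inj => /=; have := ltn_ord i; lia. Qed.

Definition upper_block m : 'M[R]_(m + m) := block_mx 1%:M 0 0 0.
Definition lower_block m : 'M[R]_(m + m) := block_mx 0 0 0 1%:M.

(* The two kinds of diagonal blocks of Pmx. *)
Definition first_twist m : 'M[R]_(m + m) := block_mx 1%:M 0 0 (- Omega R m).
Definition second_twist m : 'M[R]_(m + m) := block_mx (Omega R m) 0 0 1%:M.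

Lemma upper_block_sum m :
  upper_block m = \sum_(k < m) delta_mx (lshift m k) (lshift m k).
Proof.
have -> : \sum_(k < m) delta_mx (lshift m k) (lshift m k) =
    \sum_(k < m) block_mx (delta_mx k k) 0 0 0 :> 'M[R]_(m + m).
  apply: eq_bigr => k _; rewrite delta_mx_lshift delta_mx_ushift.
  by rewrite block_mxEh -col_mx0.
rewrite /upper_block mx1_sum_delta.
by elim/big_ind2: _ => [|A B C D <- <-|//]; rewrite ?block_mx0 // add_block_mx !addr0.
Qed.

Lemma lower_block_sum m :
  lower_block m = \sum_(k < m) delta_mx (rshift m k) (rshift m k).
Proof.
have -> : \sum_(k < m) delta_mx (rshift m k) (rshift m k) =
    \sum_(k < m) block_mx 0 0 0 (delta_mx k k) :> 'M[R]_(m + m).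
  apply: eq_bigr => k _; rewrite delta_mx_rshift delta_mx_dshift.
  by rewrite block_mxEh -col_mx0.
rewrite /lower_block mx1_sum_delta.
by elim/big_ind2: _ => [|A B C D <- <-|//]; rewrite ?block_mx0 // add_block_mx !addr0.
Qed.

Lemma upper_block_mul m (A B C D : 'M[R]_m) :
  upper_block m *m block_mx A B C D = block_mx A B 0 0.
Proof. by rewrite mulmx_block !mul1mx !mul0mx !addr0. Qed.

Lemma lower_block_mul m (A B C D : 'M[R]_m) :
  lower_block m *m block_mx A B C D = block_mx 0 0 C D.
Proof. by rewrite mulmx_block !mul1mx !mul0mx !add0r. Qed.

Lemma mul_upper_block m (A B C D : 'M[R]_m) :
  block_mx A B C D *m upper_block m = block_mx A 0 C 0.
Proof. by rewrite mulmx_block !mulmx1 !mulmx0 !addr0. Qed.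

Lemma mul_lower_block m (A B C D : 'M[R]_m) :
  block_mx A B C D *m lower_block m = block_mx 0 B 0 D.
Proof. by rewrite mulmx_block !mulmx1 !mulmx0 !add0r. Qed.

Lemma upper_lowerD m : upper_block m + lower_block m = 1%:M.
Proof. by rewrite add_block_mx !addr0 add0r -scalar_mx_block. Qed.

Lemma first_twist_sqr m : first_twist m *m first_twist m = 1%:M.
Proof.
rewrite mulmx_block !mulmx0 !mul0mx mulmx1 mulNmx mulmxN opprK Omega_sqr.
by rewrite !addr0 add0r -scalar_mx_block.
Qed.

Lemma second_twist_sqr m : second_twist m *m second_twist m = 1%:M.
Proof.
rewrite mulmx_block !mulmx0 !mul0mx mulmx1 Omega_sqr.
by rewrite !addr0 add0r -scalar_mx_block.
Qed.

Lemma trmx_first_twist m : (first_twist m)^T = first_twist m.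
Proof. by rewrite tr_block_mx !trmx0 trmx1 linearN /= trmx_Omega. Qed.

Lemma trmx_second_twist m : (second_twist m)^T = second_twist m.
Proof. by rewrite tr_block_mx !trmx0 trmx1 /= trmx_Omega. Qed.

Section TwistDelta.
Variables (m p : nat) (i : 'I_m) (y : 'I_p).

Lemma first_twist_lshift :
  first_twist m *m delta_mx (lshift m i) y = delta_mx (lshift m i) y.
Proof.
by rewrite !delta_mx_ushift mul_block_col !mulmx0 !addr0 mul1mx mul0mx.
Qed.

Lemma first_twist_rshift :
  first_twist m *m delta_mx (rshift m i) y = - delta_mx (rshift m (rev_ord i)) y.
Proof.
rewrite !delta_mx_dshift mul_block_col !mulmx0 !add0r mul0mx mulNmx Omega_delta.
by rewrite opp_col_mx oppr0.
Qed.

Lemma second_twist_lshift :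
  second_twist m *m delta_mx (lshift m i) y = delta_mx (lshift m (rev_ord i)) y.
Proof.
by rewrite !delta_mx_ushift mul_block_col !mulmx0 !addr0 mul0mx Omega_delta.
Qed.

Lemma second_twist_rshift :
  second_twist m *m delta_mx (rshift m i) y = delta_mx (rshift m i) y.
Proof.
by rewrite !delta_mx_dshift mul_block_col !mulmx0 !add0r mul0mx mul1mx.
Qed.

Lemma lshift_first_twist :
  delta_mx y (lshift m i) *m first_twist m = delta_mx y (lshift m i).
Proof.
apply: trmx_inj.
by rewrite trmx_mul trmx_first_twist !trmx_delta first_twist_lshift.
Qed.

Lemma rshift_first_twist :
  delta_mx y (rshift m i) *m first_twist m = - delta_mx y (rshift m (rev_ord i)).
Proof.
apply: trmx_inj.
by rewrite trmx_mul trmx_first_twist linearN /= !trmx_delta first_twist_rshift.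
Qed.

Lemma lshift_second_twist :
  delta_mx y (lshift m i) *m second_twist m = delta_mx y (lshift m (rev_ord i)).
Proof.
apply: trmx_inj.
by rewrite trmx_mul trmx_second_twist !trmx_delta second_twist_lshift.
Qed.

Lemma rshift_second_twist :
  delta_mx y (rshift m i) *m second_twist m = delta_mx y (rshift m i).
Proof.
apply: trmx_inj.
by rewrite trmx_mul trmx_second_twist !trmx_delta second_twist_rshift.
Qed.
End TwistDelta.

Definition twistE := (first_twist_lshift, first_twist_rshift, second_twist_lshift,
  second_twist_rshift, lshift_first_twist, rshift_first_twist,
  lshift_second_twist, rshift_second_twist).

Section Pmx.
Variables n m : nat.

Lemma PmxE : Pmx R n m =
  upper_block n *t first_twist m + lower_block n *t second_twist m.
Proof. by []. Qed.

Lemma Pmx_sqr : Pmx R n m *m Pmx R n m = 1%:M.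
Proof.
rewrite PmxE mulmxDl !mulmxDr !tensmx_mul first_twist_sqr second_twist_sqr.
rewrite !(upper_block_mul, lower_block_mul) block_mx0 !tens0mx addr0 add0r.
by rewrite -tensmxDl upper_lowerD tensmx11.
Qed.

Lemma invmx_Pmx : invmx (Pmx R n m) = Pmx R n m.
Proof.
have [uP _] := mulmx1_unit Pmx_sqr.
by rewrite -[LHS]mulmx1 -Pmx_sqr mulKmx.
Qed.

Lemma trmx_Pmx : (Pmx R n m)^T = Pmx R n m.
Proof.
rewrite PmxE linearD /= !trmx_tens trmx_first_twist trmx_second_twist.
by rewrite !tr_block_mx !trmx0 trmx1.
Qed.

(** The matrix [Pmx] is symmetric and its own inverse, so conjugation by it commutes with
    transposition. *)
Lemma trmx_if_rho_Sp e (A : 'M[R]_(n + n)) (B : 'M[R]_(m + m)) :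
  rho_Sp (trmx_if e A) (trmx_if e B) = trmx_if e (rho_Sp A B).
Proof.
case: e => //=; rewrite /rho_Sp invmx_Pmx !trmx_mul trmx_Pmx trmx_tens.
by rewrite !mulmxA.
Qed.

Lemma rho_Sp_mul (A A' : 'M[R]_(n + n)) (B B' : 'M[R]_(m + m)) :
  rho_Sp A B *m rho_Sp A' B' = rho_Sp (A *m A') (B *m B').
Proof.
rewrite /rho_Sp invmx_Pmx -tensmx_mul !mulmxA; congr (_ *m _ *m _).
by rewrite -[LHS]mulmxA Pmx_sqr mulmx1.
Qed.

Lemma rho_Sp1 : rho_Sp 1%:M 1%:M = 1%:M :> 'M[R]_((n + n) * (m + m)).
Proof. by rewrite /rho_Sp invmx_Pmx tensmx11 mulmx1 Pmx_sqr. Qed.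

Lemma rho_Sp_left (M : 'M[R]_(n + n)) t :
  rho_Sp (1%:M + t *: M) 1%:M =
  1%:M + t *: rho_Sp M 1%:M :> 'M[R]_((n + n) * (m + m)).
Proof.
rewrite -[X in _ = X + _]rho_Sp1 /rho_Sp tensmxDl tensmxZl.
rewrite invmx_Pmx; move: (Pmx R n m) => P.
by rewrite mulmxDr mulmxDl -scalemxAr -scalemxAl.
Qed.

Lemma rho_Sp_right (M : 'M[R]_(m + m)) t :
  rho_Sp 1%:M (1%:M + t *: M) =
  1%:M + t *: rho_Sp 1%:M M :> 'M[R]_((n + n) * (m + m)).
Proof.
rewrite -[X in _ = X + _]rho_Sp1 /rho_Sp tensmxDr tensmxZr.
rewrite invmx_Pmx; move: (Pmx R n m) => P.
by rewrite mulmxDr mulmxDl -scalemxAr -scalemxAl.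
Qed.

(** A block diagonal first argument meets the same twist on both sides, and each twist is an
    involution. *)
Lemma rho_Sp_diag (A D : 'M[R]_n) :
  rho_Sp (block_mx A 0 0 D) 1%:M = block_mx A 0 0 D *t 1%:M :> 'M[R]_(_ * (m + m)).
Proof.
rewrite /rho_Sp invmx_Pmx PmxE !mulmxDl !mulmxDr !tensmx_mul !mulmx1.
rewrite first_twist_sqr second_twist_sqr.
rewrite !(upper_block_mul, lower_block_mul, mul_upper_block, mul_lower_block).
rewrite block_mx0 !tens0mx !addr0 add0r -tensmxDl add_block_mx.
by rewrite !addr0 add0r.
Qed.

(** The upper right block has the first twist on its left and the second on its right. Their product
    is block diagonal with blocks [Omega m] and [- Omega m], whence the shifts by [m] and the
    opposite signs in the formulas for sums of roots. *)
Lemma rho_Sp_upper (B : 'M[R]_n) :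
  rho_Sp (block_mx 0 B 0 0) 1%:M =
  block_mx 0 B 0 0 *t (first_twist m *m second_twist m).
Proof.
rewrite /rho_Sp invmx_Pmx PmxE !mulmxDl !mulmxDr !tensmx_mul !mulmx1.
rewrite !(upper_block_mul, lower_block_mul, mul_upper_block, mul_lower_block).
by rewrite block_mx0 !tens0mx !addr0 add0r.
Qed.

Lemma rho_Sp1r (M : 'M[R]_(m + m)) : rho_Sp 1%:M M =
  upper_block n *t (first_twist m *m M *m first_twist m)
  + lower_block n *t (second_twist m *m M *m second_twist m).
Proof.
rewrite /rho_Sp invmx_Pmx PmxE !mulmxDl !mulmxDr !tensmx_mul !mulmx1.
rewrite !(upper_block_mul, lower_block_mul, mul_upper_block, mul_lower_block).
by rewrite block_mx0 !tens0mx !addr0 add0r.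
Qed.

Lemma first_second_twist : first_twist m *m second_twist m =
  \sum_(k < m) (delta_mx (lshift m k) (lshift m (rev_ord k))
                - delta_mx (rshift m k) (rshift m (rev_ord k))) :> 'M[R]_(m + m).
Proof.
rewrite -[second_twist m]mul1mx -upper_lowerD upper_block_sum lower_block_sum.
rewrite mulmxA mulmxDr mulmxDl !mulmx_sumr !mulmx_suml big_split /= sumrN.
congr (_ + _); first by apply: eq_bigr => k _; rewrite !twistE.
rewrite (reindex_inj rev_ord_inj) -sumrN; apply: eq_bigr => k _ /=.
by rewrite twistE mulNmx twistE rev_ordK.
Qed.

End Pmx.

End SymplecticBlocks.

(** * Chevalley generators of the symplectic group *)

Definition Sp_root (r : nat) (al : root_label) : bool :=
  match al with
  | Diff _ i j | Sum _ i j => [&& 0 < i, i < j & j <= r]%N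
  | Sing _ i => (0 < i <= r)%N
  end.

Section SpGenerators.
Variable R : comUnitRingType.

Lemma delta_lshift_lshift m (i j : 'I_m) :
  delta_mx (lshift m i) (lshift m j) = block_mx (delta_mx i j) 0 0 0 :> 'M[R]__.
Proof. by rewrite delta_mx_lshift delta_mx_ushift block_mxEh -col_mx0. Qed.

Lemma delta_lshift_rshift m (i j : 'I_m) :
  delta_mx (lshift m i) (rshift m j) = block_mx 0 (delta_mx i j) 0 0 :> 'M[R]__.
Proof. by rewrite delta_mx_rshift delta_mx_ushift block_mxEh -col_mx0. Qed.

Lemma delta_rshift_rshift m (i j : 'I_m) :
  delta_mx (rshift m i) (rshift m j) = block_mx 0 0 0 (delta_mx i j) :> 'M[R]__.
Proof. by rewrite delta_mx_rshift delta_mx_dshift block_mxEh -col_mx0. Qed.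

Lemma bar_lshift m (i : 'I_m) :
  ((2 * m).+1 - i.+1)%N = (rshift m (rev_ord i)).+1.
Proof. by rewrite /=; have := ltn_ord i; lia. Qed.

Lemma xSp_DiffE r e (i j : 'I_r) (t : R) : xSp r (Diff e i.+1 j.+1) t = trmx_if e
  (1%:M + t *: block_mx (delta_mx i j) 0 0 (- delta_mx (rev_ord j) (rev_ord i))).
Proof.
rewrite /= !bar_lshift.
rewrite (E_delta R (a := lshift r i) (b := lshift r j)) //.
rewrite (E_delta R (a := rshift r (rev_ord j)) (b := rshift r (rev_ord i))) //.
rewrite delta_lshift_lshift delta_rshift_rshift opp_block_mx add_block_mx.
by rewrite !oppr0 !addr0 add0r.
Qed.

Lemma xSp_SumE r e (i j : 'I_r) (t : R) : xSp r (Sum e i.+1 j.+1) t = trmx_if e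
  (1%:M + t *: block_mx 0 (delta_mx i (rev_ord j) + delta_mx j (rev_ord i)) 0 0).
Proof.
rewrite /= !bar_lshift.
rewrite (E_delta R (a := lshift r i) (b := rshift r (rev_ord j))) //.
rewrite (E_delta R (a := lshift r j) (b := rshift r (rev_ord i))) //.
by rewrite !delta_lshift_rshift add_block_mx !addr0.
Qed.

Lemma xSp_SingE r e (i : 'I_r) (t : R) : xSp r (Sing e i.+1) t = trmx_if e
  (1%:M + t *: block_mx 0 (delta_mx i (rev_ord i)) 0 0).
Proof.
rewrite /= !bar_lshift.
by rewrite (E_delta R (a := lshift r i) (b := rshift r (rev_ord i))) //
  delta_lshift_rshift.
Qed.

Lemma Psi_sqr r : Psi R r *m Psi R r = - 1%:M.
Proof.
rewrite mulmx_block !mul0mx !mulmx0 mulNmx mulmxN Omega_sqr !addr0 add0r.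
by rewrite (scalar_mx_block r r) opp_block_mx !oppr0.
Qed.

Lemma trmx_Psi r : (Psi R r)^T = - Psi R r.
Proof.
by rewrite tr_block_mx opp_block_mx !trmx0 linearN /= trmx_Omega !oppr0 opprK.
Qed.

Lemma Sp_trmx_if r e (A : 'M[R]_(r + r)) : Sp A -> Sp (trmx_if e A).
Proof.
case: e => //= SpA; have /(congr1 trmx) := mulmx1C SpA.
rewrite trmx_mul trmx1 !trmx_mul trmxK linearN /= trmx_Psi opprK.
by rewrite /Sp trmxK !mulNmx mulmxA => <-; rewrite !mulmxN.
Qed.

(** The last condition says that [M] is in the symplectic Lie algebra. As [M] squares to zero,
    [1%:M + t *: M] is its exponential, which yields both membership in the group and additivity. *)
Lemma xSp_nilpotent r al : Sp_root r al -> exists e (M : 'M[R]_(r + r)),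
  [/\ forall t, xSp r al t = trmx_if e (1%:M + t *: M), M *m M = 0
    & Psi R r *m M^T *m Psi R r = M].
Proof.
(* This is the general block upper triangular element of the Lie algebra: [X] forces the lower
   block, and [Y] is symmetric about the antidiagonal. All positive roots have [X = 0] or
   [Y = 0]. *)
have key (X Y : 'M[R]_r) : X *m X = 0 -> X = 0 \/ Y = 0 ->
    Omega R r *m Y^T *m Omega R r = Y ->
    let M := block_mx X Y 0 (- (Omega R r *m X^T *m Omega R r)) in
    M *m M = 0 /\ Psi R r *m M^T *m Psi R r = M.
  move=> XX XY YY M; split.
    rewrite /M mulmx_block !mul0mx !mulmx0 !addr0 add0r XX !(mulmxN, mulNmx) opprK.
    have -> : Omega R r *m X^T *m Omega R r *m (Omega R r *m X^T *m Omega R r) = 0.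
      rewrite !mulmxA -(mulmxA _ (Omega R r) (Omega R r)) Omega_sqr mulmx1.
      by rewrite -(mulmxA _ X^T X^T) -trmx_mul XX trmx0 mulmx0 mul0mx.
    have -> : X *m Y - Y *m (Omega R r *m X^T *m Omega R r) = 0.
      by case: XY => ->; rewrite ?trmx0 !(mul0mx, mulmx0) subr0.
    by rewrite block_mx0.
  rewrite /M /Psi tr_block_mx linearN /= !trmx_mul !trmx_Omega trmxK trmx0.
  rewrite !mulmx_block !(mul0mx, mulmx0, mulNmx, mulmxN, oppr0, addr0, add0r, opprK).
  by rewrite YY !mulmxA Omega_sqr mul1mx -mulmxA Omega_sqr mulmx1.
case: al => [e i j|e i j|e i] /=.
- case: i j => [//|i] [|j] /and3P[_ ij jr] //.
  have ir : (i < r)%N by lia.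
  pose a := Ordinal ir; pose b := Ordinal jr.
  have [|||M2 MM] := key (delta_mx a b) 0.
  + by rewrite mul_delta_mx_cond -val_eqE /= gtn_eqF.
  + by right.
  + by rewrite trmx0 mulmx0 mul0mx.
  move: M2 MM; rewrite trmx_delta Omega_delta delta_Omega => M2 MM.
  by exists e; eexists; split; [exact: (xSp_DiffE e a b) | |].
- case: i j => [//|i] [|j] /and3P[_ ij jr] //.
  have ir : (i < r)%N by lia.
  pose a := Ordinal ir; pose b := Ordinal jr.
  have [|||M2 MM] := key 0 (delta_mx a (rev_ord b) + delta_mx b (rev_ord a)).
  + by rewrite mul0mx.
  + by left.
  + rewrite linearD /= !trmx_delta mulmxDr mulmxDl !Omega_delta !delta_Omega.
    by rewrite !rev_ordK addrC.
  move: M2 MM; rewrite trmx0 mulmx0 mul0mx oppr0 => M2 MM.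
  by exists e; eexists; split; [exact: (xSp_SumE e a b) | |].
- case: i => [//|i] /andP[_ ir]; pose a := Ordinal ir.
  have [|||M2 MM] := key 0 (delta_mx a (rev_ord a)).
  + by rewrite mul0mx.
  + by left.
  + by rewrite trmx_delta Omega_delta delta_Omega rev_ordK.
  move: M2 MM; rewrite trmx0 mulmx0 mul0mx oppr0 => M2 MM.
  by exists e; eexists; split; [exact: (xSp_SingE e a) | |].
Qed.

Lemma xSp_Sp r al (t : R) : Sp_root r al -> Sp (xSp r al t).
Proof.
case/xSp_nilpotent=> e [M [-> M2 MM]]; apply: Sp_trmx_if.
have adjM : - Psi R r *m (1%:M + t *: M)^T *m Psi R r = 1%:M - t *: M.
  rewrite linearD linearZ /= trmx1 mulmxDr mulmxDl mulmx1 -scalemxAr -scalemxAl.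
  by rewrite !mulNmx Psi_sqr MM opprK scalerN.
rewrite /Sp adjM mulmxBr !mulmxDl !mul1mx mulmx1 -!scalemxAl -!scalemxAr M2.
by rewrite !scaler0 addr0 addrK.
Qed.

Lemma xSpD r al (t u : R) : Sp_root r al ->
  xSp r al (t + u) = xSp r al t *m xSp r al u.
Proof.
case/xSp_nilpotent=> e [M [xM M2 _]]; rewrite !xM.
have D v w : (1%:M + v *: M) *m (1%:M + w *: M) = 1%:M + (v + w) *: M.
  rewrite mulmxDl !mulmxDr !mul1mx mulmx1 -scalemxAl -scalemxAr M2 !scaler0.
  by rewrite addr0 scalerDl -addrA (addrC (w *: M)).
by case: e {xM} => /=; rewrite -?trmx_mul D // (addrC u).
Qed.

End SpGenerators.

Lemma trmx_if_tens (R : comNzRingType) m n e (A : 'M[R]_m) (B : 'M[R]_n) :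
  trmx_if e A *t trmx_if e B = trmx_if e (A *t B).
Proof. by case: e; rewrite /= ?trmx_tens. Qed.

Lemma trmx_if_negb (R : Type) n e (A : 'M[R]_n) :
  trmx_if (~~ e) A = trmx_if e A^T.
Proof. by case: e; rewrite /= ?trmxK. Qed.

Section SignedProducts.
Variables (R : fieldType) (K N : nat) (lift : 'M[R]_K -> 'M[R]_N -> Prop).
Hypotheses (two0 : 2%:R != 0 :> R) (cover : sign_cover lift).

Lemma one_param_big_trmx_if e (I : eqType) (s : seq I)
    (y : I -> R -> 'M[R]_K) (L : I -> 'M[R]_N) :
  uniq s ->
  (forall i, one_param lift (y i) (fun t => 1%:M + t *: trmx_if e (L i))) ->
  (forall i j, i != j -> L i *m L j = 0) ->
  one_param lift (fun t => \big[mulmx/1%:M]_(i <- s) y i t)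
    (fun t => trmx_if e (1%:M + t *: \sum_(i <- s) L i)).
Proof.
move=> s_uniq yL LL; apply: (one_param_ext _ _
  (one_param_big two0 cover s_uniq yL _)) => // [t | i j t u ij].
  by rewrite trmx_ifD trmx_if1 trmx_ifZ trmx_if_sum scaler_sumr.
rewrite -scalemxAl -scalemxAr trmx_if_orth ?scaler0 //; apply: LL => //.
by rewrite eq_sym.
Qed.

Lemma one_param_pair_trmx_if e y y' (L L' : 'M[R]_N) :
  one_param lift y (fun t => 1%:M + t *: trmx_if e L) ->
  one_param lift y' (fun t => 1%:M + t *: trmx_if e L') ->
  L *m L' = 0 -> L' *m L = 0 ->
  one_param lift (fun t => y t *m y' t)
    (fun t => 1%:M + t *: trmx_if e (L + L')).
Proof.
move=> y1 y'1 LL' L'L; apply: (one_param_ext _ _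
  (one_param_mul_orth two0 cover y1 y'1 _ _)) => // t => [|u|u].
- by rewrite trmx_ifD scalerDr.
- by rewrite -scalemxAl -scalemxAr trmx_if_orth ?scaler0.
- by rewrite -scalemxAl -scalemxAr trmx_if_orth ?scaler0.
Qed.

Lemma one_param_opp_trmx_if e y (L : 'M[R]_N) :
  one_param lift y (fun t => 1%:M + t *: trmx_if e L) ->
  one_param lift (fun t => y (- t)) (fun t => 1%:M + t *: trmx_if e (- L)).
Proof.
move/one_param_opp=> y1; apply: one_param_ext y1 => // t.
by rewrite trmx_ifN scalerN scaleNr.
Qed.
End SignedProducts.

(** * The formulas for the symplectic pair *)

Section SpFormulas.
Variables (R : fieldType) (sqrt2 : R) (n m K p q : nat).
Hypotheses (two0 : 2%:R != 0 :> R).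
Local Notation r := (n + n)%N.
Local Notation s := (m + m)%N.
Variables (lift : 'M[R]_K -> 'M[R]_(r * s) -> Prop).
Hypothesis cover : sign_cover lift.
Variables (x1 : root_label -> R -> 'M[R]_p) (x2 : root_label -> R -> 'M[R]_q).
Variables (x : root_label -> R -> 'M[R]_K) (f : 'M[R]_p -> 'M[R]_q -> 'M[R]_K).
Hypothesis x_lift : forall al, SO_root (r * s) al ->
  one_param lift (x al) (xSO sqrt2 (r * s) al).
Hypothesis x1_lift : forall al, Sp_root n al ->
  one_param lift (fun t => f (x1 al t) 1%:M)
    (fun t => rho_Sp (xSp n al t) 1%:M).
Hypothesis x2_lift : forall al, Sp_root m al ->
  one_param lift (fun t => f 1%:M (x2 al t))
    (fun t => rho_Sp 1%:M (xSp m al t)).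

Let rn : (2 * n <= r)%N. Proof. by lia. Qed.

Let skew (a b : 'I_r) (k l : 'I_s) : 'M[R]_(r * s) :=
  skew_delta R (mxtens_index (a, k)) (mxtens_index (b, l)).

Let skew_orth_left a b k l k' l' : a != b -> a != rev_ord a -> b != rev_ord b ->
  skew a b k l *m skew a b k' l' = 0.
Proof.
move=> ab aa bb; apply: skew_delta_orth; rewrite ?rev_mxtens_index mxtens_index_eq /=;
  by rewrite ?(eq_sym b a) ?(eq_sym _ a) ?(negPf ab) ?(negPf aa) ?(negPf bb).
Qed.

Let skew_orth_right (k l : 'I_n) (a b c d : 'I_s) :
  (k != l) || (b != c) && (a != d) ->
  skew (lshift n k) (lshift n k) a b *m skew (lshift n l) (lshift n l) c d = 0.
Proof.
move=> H; apply: skew_delta_orth; rewrite ?rev_mxtens_index mxtens_index_eq /=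
  -?val_eqE /=.
- by move: H; rewrite -!val_eqE /=; case: eqP => //= _; case/andP.
- by have := ltn_ord k; have := ltn_ord l; lia.
- by have := ltn_ord k; have := ltn_ord l; lia.
- by move: H; rewrite -!val_eqE /=; case: eqP => //= _; case/andP.
Qed.

Let skew_tens a b k l : skew a b k l = delta_mx a b *t delta_mx k l
  - delta_mx (rev_ord b) (rev_ord a) *t delta_mx (rev_ord l) (rev_ord k).
Proof. by rewrite /skew /skew_delta !rev_mxtens_index !tensmx_delta. Qed.

(** Reversal exchanges the upper and lower halves of the first factor, so the mirror terms of the
    first [n] blocks fill the other [n]. *)
Let sum_skew_right (c d : 'I_s) :
  \sum_(k < n) skew (lshift n k) (lshift n k) c d =
  upper_block R n *t delta_mx c d
  - lower_block R n *t delta_mx (rev_ord d) (rev_ord c).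
Proof.
under eq_bigr do rewrite skew_tens.
rewrite big_split sumrN /= upper_block_sum lower_block_sum !tensmx_suml.
congr (_ - _); rewrite [RHS](reindex_inj rev_ord_inj) /=.
by apply: eq_bigr => k _; rewrite rev_lshift.
Qed.

Let lift_left_Sum e (i j : 'I_n) (k l : 'I_s) i1 j1 :
  (mxtens_index (lshift n i, k) < mxtens_index (lshift n j, l))%N ->
  i1 = (mxtens_index (lshift n i, k)).+1 ->
  j1 = (mxtens_index (lshift n j, l)).+1 ->
  one_param lift (x (Sum e i1 j1)) (fun t => 1%:M + t *:
    trmx_if e (skew (lshift n i) (rev_ord (lshift n j)) k (rev_ord l))).
Proof.
move=> kl i1E j1E; have := lift_Sum x_lift e i1E j1E.
rewrite kl (mxtens_index_half _ rn) //= => /(_ isT) y1.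
apply: one_param_ext y1 => // t.
by rewrite long_root_trmx_if rev_mxtens_index.
Qed.

Let lift_right_Diff e (i : 'I_n) (k l : 'I_s) i1 j1 : (k < l)%N ->
  i1 = (mxtens_index (lshift n i, k)).+1 ->
  j1 = (mxtens_index (lshift n i, l)).+1 ->
  one_param lift (x (Diff e i1 j1)) (fun t => 1%:M + t *:
    trmx_if e (skew (lshift n i) (lshift n i) k l)).
Proof.
move=> kl i1E j1E; have := lift_Diff x_lift e i1E j1E.
rewrite mxtens_index_ltr kl (mxtens_index_half _ rn) //= => /(_ isT) y1.
by apply: one_param_ext y1 => // t; rewrite long_root_trmx_if.
Qed.

Let left_rho e (M : 'M[R]_r) t :
  rho_Sp (trmx_if e (1%:M + t *: M)) 1%:M =
  trmx_if e (1%:M + t *: rho_Sp M (1%:M : 'M[R]_s)).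
Proof. by rewrite -{1}(trmx_if1 R s e) trmx_if_rho_Sp rho_Sp_left. Qed.

Let right_rho e (M : 'M[R]_s) t :
  rho_Sp 1%:M (trmx_if e (1%:M + t *: M)) =
  trmx_if e (1%:M + t *: rho_Sp (1%:M : 'M[R]_r) M).
Proof. by rewrite -{1}(trmx_if1 R r e) trmx_if_rho_Sp rho_Sp_right. Qed.

Let left_neq_rev (i j : 'I_n) : lshift n i != rev_ord (lshift n j).
Proof. by rewrite -val_eqE /=; have := ltn_ord i; have := ltn_ord j; lia. Qed.

Lemma Sp_formulas : formulas_Sp n m x1 x2 x f.
Proof.
rewrite /formulas_Sp (_ : 2 * m = s)%N; last by lia.
split; [|split; [|split]].
- move=> e t [//|i] [//|j] _ ij jn; rewrite !subn1 !big_add1 !big_mkord.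
  have lt_i : (i < n)%N by lia.
  pose a := Ordinal lt_i; pose b := Ordinal jn.
  split; move: t.
  + apply: (one_param_unique two0 cover (x1_lift (al := Diff e i.+1 j.+1) _)).
      by rewrite /= ij jn.
    (* On block diagonal matrices [rho_Sp] is the plain Kronecker product, and the generators of Sp
       and SO for a difference of roots coincide, so the orthogonal formula applies. *)
    apply: (one_param_ext _ _ (left_Diff_formula two0 cover x_lift rn e
      (a := lshift n a) (b := lshift n b) (i := fun k => _) (j := fun k => _) _ _ _
        _)) => //.
    * move=> t; rewrite (xSp_DiffE e a b) left_rho rho_Sp_diag.
      rewrite (xSO_Diff sqrt2 e (a := lshift n a) (b := lshift n b)) //
        long_root_trmx_if.
      have -> : skew_delta R (lshift n a) (lshift n b) =
          block_mx (delta_mx a b) 0 0 (- delta_mx (rev_ord b) (rev_ord a)).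
        rewrite /skew_delta !rev_lshift delta_lshift_lshift delta_rshift_rshift.
        by rewrite opp_block_mx add_block_mx !oppr0 !addr0 add0r.
      rewrite -trmx_ifZ -{1}(trmx_if1 R r e) -trmx_ifD -{1}(trmx_if1 R s e).
      rewrite trmx_if_tens tensmxDl tensmx11.
      by rewrite tensmxZl.
    * by move=> k; rewrite /= mulnC addnS; lia.
    * by move=> k; rewrite /= mulnC addnS; lia.
  + apply: (one_param_unique two0 cover (x1_lift (al := Sum e i.+1 j.+1) _)).
      by rewrite /= ij jn.
    (* The generator has two matrix units and the product of twists has two signs, which gives four
       terms for each [k]. Mirror images pair them across matrix units and signs: [ll k] contains
       two of them and [- rr k] the other two. *)
    pose ll k := skew (lshift n a) (rev_ord (lshift n b)) (lshift m k) (lshift m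
      (rev_ord k)).
    pose rr k := skew (lshift n a) (rev_ord (lshift n b)) (rshift m k) (rshift m
      (rev_ord k)).
    have orth k l k' l' : skew (lshift n a) (rev_ord (lshift n b)) k l *m
        skew (lshift n a) (rev_ord (lshift n b)) k' l' = 0.
      by apply: skew_orth_left; rewrite // rev_ordK eq_sym.
    apply: (one_param_ext _ _ (one_param_big_trmx_if (e := e) two0 cover
      (index_enum_uniq _) (L := fun k => ll k - rr k) _ _)) => [//|t|k|k l _].
    * rewrite (xSp_SumE e a b) left_rho rho_Sp_upper; congr (trmx_if e (_ + _ *: _)).
      rewrite first_second_twist tensmx_sumr; apply: eq_bigr => k _.
      rewrite /ll /rr !skew_tens !rev_lshift !rev_rshift !rev_ordK.
      have -> : block_mx 0 (delta_mx a (rev_ord b) + delta_mx b (rev_ord a)) 0 0 =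
          delta_mx (lshift n a) (rshift n (rev_ord b))
          + delta_mx (lshift n b) (rshift n (rev_ord a)) :> 'M[R]_r.
        by rewrite !delta_lshift_rshift add_block_mx !addr0.
      rewrite tensmxDl !tensmxDr !tensmxNr.
      by apply/matrixP=> u v; rewrite !mxE; ring.
    * apply: (one_param_pair_trmx_if two0 cover
        (y' := fun t => x (Sum e _ _) (- t))).
      - rewrite /ll -(rev_rshift (m := m)).
        apply: lift_left_Sum.
        + exact: mxtens_index_ltl.
        + by rewrite /= mulnC; lia.
        + by rewrite /= mulnC; lia.
      - apply: one_param_opp_trmx_if; rewrite /rr -(rev_lshift (m := m)).
        apply: lift_left_Sum.
        + exact: mxtens_index_ltl.
        + by rewrite /= mulnC; lia.
        + by rewrite /= mulnC; lia.
      - by rewrite /ll /rr mulmxN orth oppr0.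
      - by rewrite /ll /rr mulNmx orth oppr0.
    * by rewrite mulmxBl (mulmxBr (ll k)) (mulmxBr (rr k)) /ll /rr !orth !subr0.
- move=> e t [//|i] _ i_n; rewrite !subn1 !big_add1 !big_mkord.
  pose a := Ordinal i_n; move: t.
  apply: (one_param_unique two0 cover (x1_lift (al := Sing e i.+1) _)) => //.
  (* With a single matrix unit, the mirror image of the term with [Omega] is the term with
     [- Omega], so one skew element for each [k] suffices. *)
  pose ll k := skew (lshift n a) (rev_ord (lshift n a)) (lshift m k) (lshift m
    (rev_ord k)).
  have orth k l k' l' : skew (lshift n a) (rev_ord (lshift n a)) k l *m
      skew (lshift n a) (rev_ord (lshift n a)) k' l' = 0.
    by apply: skew_orth_left; rewrite // rev_ordK eq_sym.
  apply: (one_param_ext _ _ (one_param_big_trmx_if (e := e) two0 cover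
    (index_enum_uniq _) (L := ll) _ _)) => [//|t|k|k l _].
  + rewrite (xSp_SingE e a) left_rho rho_Sp_upper; congr (trmx_if e (_ + _ *: _)).
    rewrite first_second_twist tensmx_sumr; apply: eq_bigr => k _.
    rewrite /ll skew_tens !rev_lshift !rev_rshift !rev_ordK -delta_lshift_rshift.
    by rewrite tensmxDr tensmxNr.
  + rewrite /ll -(rev_rshift (m := m)).
    apply: lift_left_Sum.
    * by rewrite mxtens_index_ltr /=; have := ltn_ord k; lia.
    * by rewrite /= mulnC; lia.
    * by rewrite /= mulnC; lia.
  + exact: orth.
- move=> e u [//|i] [//|j] _ ij jm; rewrite !big_mkord.
  have lt_i : (i < m)%N by lia.
  pose a := Ordinal lt_i; pose b := Ordinal jm.
  have ab : a != b by rewrite -val_eqE /= ltn_eqF.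
  have lr (c d : 'I_m) : (lshift m c == rshift m d) = false.
    by rewrite -val_eqE /=; have := ltn_ord c; lia.
  have rl (c d : 'I_m) : (rshift m c == lshift m d) = false.
    by rewrite eq_sym lr.
  split; move: u.
  + apply: (one_param_unique two0 cover (x2_lift (al := Diff e i.+1 j.+1) _)).
      by rewrite /= ij jm.
    pose L1 (k : 'I_n) := skew (lshift n k) (lshift n k) (lshift m a) (lshift m b).
    (* Conjugation by the first twist reverses both indices of the lower right unit, whose two signs
       cancel. What remains has row [b] and column [a], hence the opposite root in the second
       factor. *)
    pose L2 (k : 'I_n) := skew (lshift n k) (lshift n k) (rshift m b) (rshift m a).
    apply: (one_param_ext _ _ (one_param_big_trmx_if (e := e) two0 cover
      (index_enum_uniq _) (L := fun k => L1 k - L2 k) _ _)) => [//|t|k|k l kl].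
    * rewrite (xSp_DiffE e a b) right_rho; congr (trmx_if e (_ + _ *: _)).
      have -> : block_mx (delta_mx a b) 0 0 (- delta_mx (rev_ord b) (rev_ord a)) =
          delta_mx (lshift m a) (lshift m b)
          - delta_mx (rshift m (rev_ord b)) (rshift m (rev_ord a)) :> 'M[R]_s.
        rewrite delta_lshift_lshift delta_rshift_rshift opp_block_mx.
        by rewrite add_block_mx !oppr0 !addr0 add0r.
      rewrite big_split sumrN /= !sum_skew_right !rev_lshift !rev_rshift rho_Sp1r.
      rewrite !(mulmxBr, mulmxBl, mulNmx, mulmxN, twistE, opprK, rev_ordK).
      rewrite !(tensmxDr, tensmxNr).
      by apply/matrixP=> v w; rewrite !mxE; ring.
    * apply: (one_param_pair_trmx_if two0 cover
        (y' := fun t => x (Diff (~~ e) _ _) (- t))).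
      - apply: lift_right_Diff.
        + by rewrite /=; lia.
        + by rewrite /= mulnC; lia.
        + by rewrite /= mulnC; lia.
      - apply: one_param_opp_trmx_if; rewrite /L2 /skew -trmx_skew_delta
        -trmx_if_negb.
        apply: lift_right_Diff.
        + by rewrite /=; lia.
        + by rewrite /= mulnC; lia.
        + by rewrite /= mulnC; lia.
      - by rewrite mulmxN skew_orth_right ?oppr0 // lr lr orbT.
      - by rewrite mulNmx skew_orth_right ?oppr0 // rl rl orbT.
    * rewrite mulmxBl (mulmxBr (L1 k)) (mulmxBr (L2 k)) /L1 /L2.
      by rewrite !skew_orth_right ?kl // !subr0.
  + apply: (one_param_unique two0 cover (x2_lift (al := Sum e i.+1 j.+1) _)).
      by rewrite /= ij jm.
    (* An upper right unit meets [- Omega m] on one side only, so its sign survives; this is why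
       both parameters are negated. *)
    pose L1 (k : 'I_n) := skew (lshift n k) (lshift n k) (lshift m a) (rshift m b).
    pose L2 (k : 'I_n) := skew (lshift n k) (lshift n k) (lshift m b) (rshift m a).
    apply: (one_param_ext _ _ (one_param_big_trmx_if (e := e) two0 cover
      (index_enum_uniq _) (L := fun k => - L1 k - L2 k) _ _)) => [//|t|k|k l kl].
    * rewrite (xSp_SumE e a b) right_rho; congr (trmx_if e (_ + _ *: _)).
      have -> : block_mx 0 (delta_mx a (rev_ord b) + delta_mx b (rev_ord a)) 0 0 =
          delta_mx (lshift m a) (rshift m (rev_ord b))
          + delta_mx (lshift m b) (rshift m (rev_ord a)) :> 'M[R]_s.
        by rewrite !delta_lshift_rshift add_block_mx !addr0.
      rewrite big_split !sumrN /= !sum_skew_right !rev_lshift !rev_rshift rho_Sp1r.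
      rewrite !(mulmxDr, mulmxDl, mulNmx, mulmxN, twistE, opprK, rev_ordK).
      rewrite !(tensmxDr, tensmxNr).
      by apply/matrixP=> v w; rewrite !mxE; ring.
    * apply: (one_param_pair_trmx_if two0 cover (y := fun t => x (Diff e _ _) (- t))
        (y' := fun t => x (Diff e _ _) (- t))).
      - apply: one_param_opp_trmx_if; apply: lift_right_Diff.
        + by rewrite /=; lia.
        + by rewrite /= mulnC; lia.
        + by rewrite /= mulnC; lia.
      - apply: one_param_opp_trmx_if; apply: lift_right_Diff.
        + by rewrite /=; lia.
        + by rewrite /= mulnC; lia.
        + by rewrite /= mulnC; lia.
      - by rewrite mulNmx mulmxN skew_orth_right ?oppr0 // lr rl orbT.
      - by rewrite mulNmx mulmxN skew_orth_right ?oppr0 // lr rl orbT.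
    * rewrite -[- L1 k - _]opprD -[- L1 l - _]opprD mulNmx mulmxN opprK.
      rewrite mulmxDl (mulmxDr (L1 k)) (mulmxDr (L2 k)) /L1 /L2.
      by rewrite !skew_orth_right ?kl // !addr0.
- move=> e u [//|i] _ im; rewrite !big_mkord.
  pose a := Ordinal im; move: u.
  apply: (one_param_unique two0 cover (x2_lift (al := Sing e i.+1) _)) => //.
  apply: (one_param_ext _ _ (one_param_big_trmx_if (e := e) two0 cover
    (index_enum_uniq _) (L := fun k : 'I_n =>
      - skew (lshift n k) (lshift n k) (lshift m a) (rshift m a)) _ _)) =>
        [//|t|k|k l kl].
  + rewrite (xSp_SingE e a) right_rho; congr (trmx_if e (_ + _ *: _)).
    rewrite sumrN sum_skew_right rev_lshift rev_rshift rho_Sp1r -delta_lshift_rshift.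
    rewrite !(mulNmx, mulmxN, twistE, opprK, rev_ordK) tensmxNr.
    by rewrite opprB addrC.
  + apply: one_param_opp_trmx_if; apply: lift_right_Diff.
    * by rewrite /=; lia.
    * by rewrite /= mulnC; lia.
    * by rewrite /= mulnC; lia.
  + by rewrite mulNmx mulmxN skew_orth_right ?kl // !oppr0.
Qed.
End SpFormulas.

(** * The identity elements of the groups *)

Section Identities.
Variable R : comUnitRingType.

Lemma SO1 d : SO (1%:M : 'M[R]_d).
Proof. by split; rewrite ?det1 // trmx1 mul1mx mulmx1 Omega_sqr. Qed.

Lemma Sp1 r : Sp (1%:M : 'M[R]_(r + r)).
Proof. by rewrite /Sp mul1mx trmx1 mulmx1 mulNmx Psi_sqr opprK. Qed.

Lemma Spin_proj1 d : Spin_proj (1%:M : 'M[R]_#|{set 'I_d}|) (1%:M : 'M[R]_d).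
Proof.
have [_ _ act1] := spin_lift1 R d.
split; [split | exact: SO1 | exact: act1]; last by exists 1%:M; [exact: SO1 |].
exists (fun S => (S == set0)%:R).
have sum_set0 (F : {set 'I_d} -> 'M[R]_#|{set 'I_d}|) :
    \sum_S (S == set0)%:R *: F S = F set0.
  rewrite (bigD1 set0) //= eqxx scale1r big1 ?addr0 // => S /negbTE->.
  by rewrite scale0r.
split=> [S||]; first by case: eqP => [->|//]; rewrite cards0.
  by rewrite /cliff sum_set0 enum_set0 big_nil.
by rewrite /cliff /cliff_rev !sum_set0 enum_set0 !big_nil mulmx1.
Qed.

End Identities.

Lemma Spin_generators_lift (R : fieldType) (sqrt2 : R) d x al :
  Spin_generators sqrt2 x -> SO_root d al ->
  one_param (@spin_lift R d) (x al) (xSO sqrt2 d al).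
Proof. by move=> gen /gen[xD xP]; split=> // t; apply: Spin_proj_lift. Qed.

(** * Images of root subgroups under the lifted and the original maps *)

Section PhiLifts.
Variables (F : fieldType) (R : fieldType) (a : {rmorphism F -> R}).

(** Additivity is multiplicativity of [phi] with the other argument fixed at the identity; the
    lifting property is compatibility with the projection. *)
Lemma phi_Sp_left n m phi al : is_phi_Sp (n := n) (m := m) phi -> Sp_root n al ->
  one_param (@spin_lift R ((n + n) * (m + m)))
    (fun t => phi R a (xSp n al t) 1%:M) (fun t => rho_Sp (xSp n al t) 1%:M).
Proof.
move=> [[_ phiM _] phiP] Hal; split=> [t u | t].
  rewrite xSpD // -{1}[1%:M]mulmx1 phiM //; by [exact: xSp_Sp | exact: Sp1].
by apply/Spin_proj_lift/phiP; [apply: xSp_Sp | apply: Sp1].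
Qed.

Lemma phi_Sp_right n m phi al : is_phi_Sp (n := n) (m := m) phi -> Sp_root m al ->
  one_param (@spin_lift R ((n + n) * (m + m)))
    (fun t => phi R a 1%:M (xSp m al t)) (fun t => rho_Sp 1%:M (xSp m al t)).
Proof.
move=> [[_ phiM _] phiP] Hal; split=> [t u | t].
  rewrite xSpD // -{1}[1%:M]mulmx1 phiM //; by [exact: xSp_Sp | exact: Sp1].
by apply/Spin_proj_lift/phiP; [apply: Sp1 | apply: xSp_Sp].
Qed.

Variable sqrt2 : R.

Lemma phi_Spin_left r s phi x1 al : is_phi_Spin (r := r) (s := s) phi ->
  Spin_generators sqrt2 x1 -> SO_root r al ->
  one_param (@spin_lift R (r * s))
    (fun t => phi R a (x1 al t) 1%:M) (fun t => xSO sqrt2 r al t *t 1%:M).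
Proof.
move=> [[_ phiM _] phiP] gen /gen[xD xP]; split=> [t u | t].
  have xS v : Spin (x1 al v) by case: (xP v).
  have [S1 _ _] := Spin_proj1 R s.
  by rewrite xD -{1}[1%:M]mulmx1 phiM.
by apply/Spin_proj_lift/phiP => //; exact: Spin_proj1.
Qed.

Lemma phi_Spin_right r s phi x2 al : is_phi_Spin (r := r) (s := s) phi ->
  Spin_generators sqrt2 x2 -> SO_root s al ->
  one_param (@spin_lift R (r * s))
    (fun t => phi R a 1%:M (x2 al t)) (fun t => 1%:M *t xSO sqrt2 s al t).
Proof.
move=> [[_ phiM _] phiP] gen /gen[xD xP]; split=> [t u | t].
  have xS v : Spin (x2 al v) by case: (xP v).
  have [S1 _ _] := Spin_proj1 R r.
  by rewrite xD -{1}[1%:M]mulmx1 phiM.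
by apply/Spin_proj_lift/phiP => //; exact: Spin_proj1.
Qed.

Hypothesis sqrt2K : sqrt2 ^+ 2 = 2%:R.

Lemma rho_SO_left r s al : SO_root r al -> one_param eq
  (fun t => rho_SO (xSO sqrt2 r al t) (1%:M : 'M[R]_s))
  (fun t => xSO sqrt2 r al t *t 1%:M).
Proof.
case/(xSO_one_param sqrt2K)=> xD _; split=> // t u.
by rewrite /rho_SO xD tensmx_mul mulmx1.
Qed.

Lemma rho_SO_right r s al : SO_root s al -> one_param eq
  (fun t => rho_SO (1%:M : 'M[R]_r) (xSO sqrt2 s al t))
  (fun t => 1%:M *t xSO sqrt2 s al t).
Proof.
case/(xSO_one_param sqrt2K)=> xD _; split=> // t u.
by rewrite /rho_SO xD tensmx_mul mulmx1.
Qed.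

Lemma rho_Sp_left_hom n m al : Sp_root n al -> one_param eq
  (fun t : R => rho_Sp (xSp n al t) (1%:M : 'M[R]_(m + m)))
  (fun t => rho_Sp (xSp n al t) 1%:M).
Proof. by move=> Hal; split=> // t u; rewrite xSpD // rho_Sp_mul mulmx1. Qed.

Lemma rho_Sp_right_hom n m al : Sp_root m al -> one_param eq
  (fun t : R => rho_Sp (1%:M : 'M[R]_(n + n)) (xSp m al t))
  (fun t => rho_Sp 1%:M (xSp m al t)).
Proof. by move=> Hal; split=> // t u; rewrite xSpD // rho_Sp_mul mulmx1. Qed.

End PhiLifts.

Theorem proposition2 (F : fieldType) (hF : 2%N \notin [pchar F])
    (Fsep : fieldType) (iota : {rmorphism F -> Fsep})
    (hsep : separable_closure iota)
    (sqrt2 : Fsep) (hsqrt2 : sqrt2 ^+ 2 = 2%:R)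
    (n m : nat) (hn : (1 <= n)%N) (hm : (1 <= m)%N) :
  (* (I) *)
  ((forall (phi : point_map2 F (n + n) (m + m) #|{set 'I_((n + n) * (m + m))}|)
           (x : root_label -> Fsep -> 'M[Fsep]_#|{set 'I_((n + n) * (m + m))}|),
      is_phi_Sp phi -> Spin_generators sqrt2 x ->
      formulas_Sp n m (@xSp Fsep n) (@xSp Fsep m) x (phi Fsep iota))
   /\
   formulas_Sp n m (@xSp Fsep n) (@xSp Fsep m)
     (xSO sqrt2 ((n + n) * (m + m))) (@rho_Sp Fsep n m))
  /\
  (* (II) *)
  (forall s : nat, s = (2 * m)%N \/ s = (2 * m + 1)%N ->
   (forall (phi : point_map2 F #|{set 'I_(2 * n)}| #|{set 'I_s}|
                    #|{set 'I_(2 * n * s)}|)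
           (x1 : root_label -> Fsep -> 'M[Fsep]_#|{set 'I_(2 * n)}|)
           (x2 : root_label -> Fsep -> 'M[Fsep]_#|{set 'I_s}|)
           (x : root_label -> Fsep -> 'M[Fsep]_#|{set 'I_(2 * n * s)}|),
      is_phi_Spin phi -> Spin_generators sqrt2 x1 ->
      Spin_generators sqrt2 x2 -> Spin_generators sqrt2 x ->
      formulas_SO_even sqrt2 n s x1 x2 x (phi Fsep iota))
   /\
   formulas_SO_even sqrt2 n s (xSO sqrt2 (2 * n)) (xSO sqrt2 s)
     (xSO sqrt2 (2 * n * s)) (@rho_SO Fsep (2 * n) s))
  /\
  (* (III) *)
  ((forall (phi : point_map2 F #|{set 'I_(2 * n + 1)}| #|{set 'I_(2 * m + 1)}|
                    #|{set 'I_((2 * n + 1) * (2 * m + 1))}|)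
           (x1 : root_label -> Fsep -> 'M[Fsep]_#|{set 'I_(2 * n + 1)}|)
           (x2 : root_label -> Fsep -> 'M[Fsep]_#|{set 'I_(2 * m + 1)}|)
           (x : root_label -> Fsep ->
                'M[Fsep]_#|{set 'I_((2 * n + 1) * (2 * m + 1))}|),
      is_phi_Spin phi -> Spin_generators sqrt2 x1 ->
      Spin_generators sqrt2 x2 -> Spin_generators sqrt2 x ->
      formulas_SO_odd sqrt2 n m x1 x2 x (phi Fsep iota))
   /\
   formulas_SO_odd sqrt2 n m (xSO sqrt2 (2 * n + 1)) (xSO sqrt2 (2 * m + 1))
     (xSO sqrt2 ((2 * n + 1) * (2 * m + 1)))
     (@rho_SO Fsep (2 * n + 1) (2 * m + 1))).
Proof.
have two0 : 2%:R != 0 :> Fsep.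
  apply: contra hF => two0; rewrite inE /=.
  by rewrite -(fmorph_eq0 iota) rmorph_nat.
have gen d := fun al (H : SO_root d al) => xSO_one_param hsqrt2 H.
split; [|split].
- split=> [phi x phiP xP|].
    apply: (Sp_formulas (sqrt2 := sqrt2) two0 (sign_cover_spin _ two0)) => al.
    + exact: (Spin_generators_lift xP).
    + exact: (phi_Sp_left _ phiP).
    + exact: (phi_Sp_right _ phiP).
  apply: (Sp_formulas (sqrt2 := sqrt2) two0 (sign_cover_eq _ _)) => al.
  + exact: gen.
  + exact: rho_Sp_left_hom.
  + exact: rho_Sp_right_hom.
- move=> s _; split=> [phi x1 x2 x phiP x1P x2P xP|].
    apply: (even_formulas two0 hsqrt2 (sign_cover_spin _ two0)) => al.
    + exact: (Spin_generators_lift xP).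
    + exact: (phi_Spin_left _ phiP x1P).
    + exact: (phi_Spin_right _ phiP x2P).
  apply: (even_formulas two0 hsqrt2 (sign_cover_eq _ _)) => al.
  + exact: gen.
  + exact: rho_SO_left.
  + exact: rho_SO_right.
- split=> [phi x1 x2 x phiP x1P x2P xP|].
    apply: (odd_formulas two0 hsqrt2 (sign_cover_spin _ two0)) => al.
    + exact: (Spin_generators_lift xP).
    + exact: (phi_Spin_left _ phiP x1P).
    + exact: (phi_Spin_right _ phiP x2P).
  apply: (odd_formulas two0 hsqrt2 (sign_cover_eq _ _)) => al.
  + exact: gen.
  + exact: rho_SO_left.
  + exact: rho_SO_right.
Qed.
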